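(* Let $w\in S_n$ be a 1432-avoiding permutation. (1) For each square $B=(i,j)\in D(w)$, set $E_B=\bigcup_{T\in \mathrm{SRT}(w,\mathbf{f}_0)}T(i,j)$. Then $$\mathfrak{G}_{w}(\mathbf{x},\mathbf{y})= \sum_{T\in \mathrm{LSVRT}(w,\mathbf{f}_0)}\ \prod_{B=(i,j)\in D(w)}\left(\prod_{t\in T(i,j)}\bigl(x_t\oplus y_{m_{ij}(w)+i-t}\bigr)\cdot\prod_{t\in E_B\setminus T(i,j)}(1-x_t)\bigl(1-y_{m_{ij}(w)+i-t}\bigr)\right).$$ (2) Given $T\in \mathrm{SRT}(w,\mathbf{f}_0)$ and a square $B\in D(w)$, let $Y_{T,B}$ be the set of positive integers $m$ such that $m$ is larger than the (unique) integer in $T(B)$ and replacing the integer in $T(B)$ by $m$ still yields a Rothe tableau in $\mathrm{SRT}(w,\mathbf{f}_0)$. Then $$\mathfrak{G}_{w}(\mathbf{x},\mathbf{y})= \sum_{T\in \mathrm{SRT}(w,\mathbf{f}_0)}\ \prod_{B=(i,j)\in D(w)}\left(\prod_{t\in T(i,j)} \bigl(x_t\oplus y_{m_{ij}(w)+i-t}\bigr)\cdot\prod_{t\in Y_{T,B}}(1-x_t)\bigl(1-y_{m_{ij}(w)+i-t}\bigr)\right).$$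
   Context: $S_n$ is the set of permutations $w=w_1w_2\cdots w_n$ of $\{1,\ldots,n\}$. $w$ is 1432-avoiding if there are no indices $i_1<i_2<i_3<i_4$ with $w_{i_1}<w_{i_4}<w_{i_3}<w_{i_2}$. The length $\ell(w)$ is the number of inversions, i.e. pairs $i<j$ with $w_i>w_j$. Rothe diagram: in an $n\times n$ grid, $(i,j)$ denotes the square in row $i$ (from top) and column $j$ (from left). $D(w)$ is the set of squares $(i,j)$ such that $w_i>j$ and $w_h=j$ for some $h>i$. For $(i,j)\in D(w)$ put $m_{ij}(w)=|\{(i,k)\in D(w) : k\le j\}|$. Notation: $x\oplus y=x+y-xy$. Tableaux: $\mathrm{SRT}(w,\mathbf{f})$, for a vector $\mathbf{f}=(f_1,\ldots,f_n)$ of nonnegative integers, is the set of (single-valued) Rothe tableaux of shape $D(w)$ flagged by $\mathbf{f}$: fillings $T$ assigning to each square $(i,j)\in D(w)$ a set $T(i,j)$ consisting of exactly one positive integer, such that entries are weakly decreasing from left to right along each row of $D(w)$, strictly increasing from top to bottom along each column of $D(w)$, and every entry in row $i$ is at most $f_i$. A limit set-valued Rothe tableau of shape $D(w)$ is an assignment of finite nonempty sets $T(B)$ of positive integers to the squares $B\in D(w)$ such that one can pick out one integer from each square to form a single-valued Rothe tableau (rows weakly decreasing, columns strictly increasing). For $B=(i,j)$, $T(B)$ and $T(i,j)$ denote the same set. $\mathrm{LSVRT}(w,\mathbf{f})$ is the set of limit set-valued Rothe tableaux of shape $D(w)$ flagged by $\mathbf{f}$, i.e. those for which every integer in row $i$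 is at most $f_i$. Throughout, $\mathbf{f}_0=(1,2,\ldots,n)$. Double Grothendieck polynomials: let $s_i$ be the transposition of $i$ and $i+1$; $ws_i$ is obtained from $w$ by swapping $w_i$ and $w_{i+1}$. Acting only on the $\mathbf{x}$-variables, $\partial_i f=\frac{f-s_if}{x_i-x_{i+1}}$, where $s_if$ interchanges $x_i$ and $x_{i+1}$ in $f$, and $\pi_i f=\partial_i((1-x_{i+1})f)$. For $w_0=n\,(n-1)\cdots 1$, $\mathfrak{G}_{w_0}(\mathbf{x},\mathbf{y})=\prod_{i+j\le n}(x_i+y_j-x_iy_j)$ (product over $i,j\ge1$); for $w\ne w_0$, $\mathfrak{G}_w(\mathbf{x},\mathbf{y})=\pi_i\mathfrak{G}_{ws_i}(\mathbf{x},\mathbf{y})$ for any $i$ with $\ell(ws_i)=\ell(w)+1$ (independent of the choice).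
   Formalization: In part (1) the sum is restricted to those T in LSVRT(w,f_0) with T(B) ⊆ E_B for every square B; without this the formula fails, e.g. for w = 231, where the filling {1},{1,2} adds a nonzero extra term. *)

(* Defs.v *)
From HB Require Import structures.
From mathcomp Require Import all_boot all_order all_algebra all_fingroup.
From mathcomp Require Import mpoly zify ring.

Set Implicit Arguments.
Unset Strict Implicit.
Unset Printing Implicit Defensive.

Import GRing.Theory.
Local Open Scope ring_scope.

(** Permutations [w : 'S_n] act on [0 .. n-1], so [w i] is the value [w_{i+1} - 1]
    of the one-line notation.  Rows and columns are 0-based as well, whereas tableau
    entries and the indices of the variables [x_t], [y_k] are 1-based. *)

(** * Permutations *)

Section Permutations.
Variable n : nat.
Implicit Types (v w : 'S_n) (i j : 'I_n).

Definition avoids1432 w : bool :=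
  ~~ [exists i1 : 'I_n, exists i2 : 'I_n, exists i3 : 'I_n, exists i4 : 'I_n,
        [&& i1 < i2, i2 < i3, i3 < i4, w i1 < w i4, w i4 < w i3 & w i3 < w i2]%N].

Definition inversions w : {set 'I_n * 'I_n} :=
  [set p : 'I_n * 'I_n | (p.1 < p.2)%N && (w p.2 < w p.1)%N].

Definition perm_length w : nat := #|inversions w|.

Definition longest : 'S_n := perm (@rev_ord_inj n).

(** The last index is its own [nexto], so its [simple_refl] is trivial. *)
Definition nexto i : 'I_n := insubd i i.+1.

Definition simple_refl i : 'S_n := tperm i (nexto i).

(** [(s * t) k = t (s k)] in MathComp: this is the permutation [w s_i], whose one-line
    notation is that of [w] with positions [i] and [i + 1] swapped. *)
Definition swap_pos w i : 'S_n := (simple_refl i * w)%g.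

Definition ascent w i : bool := perm_length (swap_pos w i) == (perm_length w).+1.

Lemma nextoK i : (i.+1 < n)%N -> nexto i = i.+1 :> nat.
Proof. by move=> lti; rewrite /nexto val_insubd lti. Qed.

Lemma nexto_id i : ~~ (i.+1 < n)%N -> nexto i = i.
Proof. by move=> lti; apply: val_inj; rewrite /nexto val_insubd (negbTE lti). Qed.

Lemma simple_reflK i k : simple_refl i (simple_refl i k) = k.
Proof. exact: tpermK. Qed.

Lemma swap_posE w i k : swap_pos w i k = w (simple_refl i k).
Proof. by rewrite /swap_pos permM. Qed.

Lemma swap_posK w i : swap_pos (swap_pos w i) i = w.
Proof. by apply/permP => k; rewrite !swap_posE simple_reflK. Qed.

Lemma swap_pos_length w i : (i.+1 < n)%N -> (w i < w (nexto i))%N ->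
  perm_length (swap_pos w i) = (perm_length w).+1.
Proof.
move=> lti ltw; have vi := nextoK lti.
pose s := simple_refl i.
pose F (p : 'I_n * 'I_n) := (s p.1, s p.2).
have FK : involutive F by case=> a b; rewrite /F /= !simple_reflK.
rewrite /perm_length (cardsD1 (i, nexto i)) inE /= !swap_posE.
rewrite /simple_refl tpermL tpermR vi leqnn ltw /= add1n.
congr _.+1; rewrite -(card_imset (mem (inversions w)) (inv_inj FK)).
apply: eq_card => -[a b]; transitivity (F (a, b) \in inversions w); last first.
  apply/idP/imsetP => [FI|[p pI ->]]; last by rewrite FK.
  by exists (F (a, b)) => //; rewrite FK.
rewrite !inE /= !swap_posE xpair_eqE -/s.
case: (ltnP (w (s b)) (w (s a))) => [ltw'|]; last by rewrite !andbF.
rewrite !andbT; move: ltw'; rewrite /s /simple_refl -!(inj_eq val_inj) /= vi.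
have [oa ob] : (forall c : 'I_n, c <> i -> c != i :> nat) /\
    (forall c : 'I_n, c <> nexto i -> c != i.+1 :> nat).
  by split=> c /eqP; rewrite -(inj_eq val_inj) /= ?vi.
case: (tpermP i (nexto i) a) => [->|->|/oa + /ob];
  case: (tpermP i (nexto i) b) => [->|->|/oa + /ob]; rewrite ?vi; try lia.
Qed.

Lemma ascentE w i : ascent w i = (i.+1 < n)%N && (w i < w (nexto i))%N.
Proof.
rewrite /ascent; case: (boolP (i.+1 < n)%N) => [lti|/nexto_id idi] /=; last first.
  have -> : swap_pos w i = w.
    by apply/permP => k; rewrite swap_posE /simple_refl idi tperm1 perm1.
  by apply/negbTE; lia.
case: (ltnP (w i)) => [ltw|gew]; first by rewrite swap_pos_length ?eqxx.
have {}gew : (swap_pos w i i < swap_pos w i (nexto i))%N.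
  rewrite !swap_posE /simple_refl tpermL tpermR ltn_neqAle gew andbT.
  by rewrite (inj_eq val_inj) (inj_eq perm_inj) -(inj_eq val_inj) /= nextoK //; lia.
have := swap_pos_length lti gew; rewrite swap_posK => ->.
by apply/negbTE; lia.
Qed.

Lemma longest_ascent w : w != longest -> exists i, ascent w i.
Proof.
move=> nw; apply/existsP; apply: contraNT nw; rewrite negb_exists => /forallP na.
have desc (i j : 'I_n) : j = i.+1 :> nat -> (w j < w i)%N.
  move=> ij; have lti : (i.+1 < n)%N by rewrite -ij.
  have -> : j = nexto i by apply: val_inj; rewrite /= nextoK.
  have := na i; rewrite ascentE lti /= -leqNgt leq_eqVlt => /orP[/eqP|//].
  by move/val_inj/perm_inj/(congr1 val); rewrite /= nextoK //; lia.
have up k (i : 'I_n) : i = k :> nat -> (w i + k < n)%N.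
  elim: k i => [|k IH] i ik; first by rewrite addn0.
  have ltk : (k < n)%N by have := ltn_ord i; lia.
  by have := IH (Ordinal ltk) erefl; have := desc (Ordinal ltk) i ik; lia.
have lo k (i : 'I_n) : (i + k = n.-1)%N -> (k <= w i)%N.
  elim: k i => [//|k IH] i ik.
  have lti : (i.+1 < n)%N by lia.
  by have := IH (Ordinal lti) _; have := desc i (Ordinal lti) erefl; rewrite /=; lia.
apply/eqP/permP => i; rewrite permE; apply: val_inj => /=.
by have := up i i erefl; have := lo (n.-1 - i)%N i; have := ltn_ord i; lia.
Qed.

Lemma longestN_ascent i : ascent longest i = false.
Proof.
rewrite ascentE; case: (boolP (i.+1 < n)%N) => //= lti.
by rewrite !permE /= nextoK //; lia.
Qed.

Lemma simple_refl_comm i j : (i.+1 < n)%N -> (j.+1 < n)%N -> (i.+1 < j)%N ->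
  (simple_refl i * simple_refl j = simple_refl j * simple_refl i)%g.
Proof.
move=> lti ltj ltij; apply/permP => k; rewrite !permM /simple_refl.
have vi := nextoK lti; have vj := nextoK ltj.
have d (a b : 'I_n) : a != b :> nat -> a != b by apply: contraNneq => ->.
case: (tpermP i (nexto i) k) => [->|->|/eqP k1 /eqP k2].
- by rewrite !(tpermD (x := j)) ?tpermL //; apply: d; rewrite ?vi ?vj; lia.
- by rewrite !(tpermD (x := j)) ?tpermR //; apply: d; rewrite ?vi ?vj; lia.
case: (tpermP j (nexto j) k) => [_|_|_ _].
- by rewrite tpermD //; apply: d; rewrite ?vi ?vj; lia.
- by rewrite tpermD //; apply: d; rewrite ?vi ?vj; lia.
- by rewrite tpermD // eq_sym.
Qed.

Lemma simple_refl_braid i : (i.+2 < n)%N -> let j := nexto i in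
  (simple_refl i * simple_refl j * simple_refl i =
   simple_refl j * simple_refl i * simple_refl j)%g.
Proof.
move=> lti j; have vj : j = i.+1 :> nat by apply: nextoK; lia.
have vk : nexto j = i.+2 :> nat by rewrite nextoK vj.
have d (a b : 'I_n) : a != b :> nat -> a != b by apply: contraNneq => ->.
rewrite /simple_refl -/j; set k := nexto j in vk *.
have ij : i != j by apply: d; lia.
have jk : j != k by apply: d; lia.
have ik : i != k by apply: d; lia.
have -> : (tperm i j * tperm j k * tperm i j = tperm i k)%g.
  by rewrite -{1}(tpermV i j) -mulgA -conjgE tpermJ tpermR tpermD.
by rewrite -{1}(tpermV j k) -mulgA -conjgE tpermJ tpermL tpermD // eq_sym.
Qed.

Section ChoiceIndependence.
Variables (A : Type) (op : 'I_n -> A -> A) (G : 'S_n -> A).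
Hypothesis op_comm : forall i j a, (i.+1 < n)%N -> (j.+1 < n)%N -> (i.+1 < j)%N ->
  op i (op j a) = op j (op i a).
Hypothesis op_braid : forall i a, (i.+2 < n)%N ->
  op i (op (nexto i) (op i a)) = op (nexto i) (op i (op (nexto i) a)).
Hypothesis G_pick : forall w i, ascent w i ->
  exists2 r, ascent w r & G w = op r (G (swap_pos w r)).

Lemma ascent_independence w i : ascent w i -> G w = op i (G (swap_pos w i)).
Proof.
have [m] := ubnP (n ^ 2 - perm_length w)%N; elim: m w i => // m IHm w i ltm ai.
have IH v j : (perm_length w < perm_length v)%N -> ascent v j ->
    G v = op j (G (swap_pos v j)).
  move=> ltv aj; apply: IHm => //.
  have := max_card (mem (inversions v)); rewrite card_prod card_ord -/(perm_length _); lia.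
have [r ar ->] := G_pick ai.
wlog ltir : i r ai ar / (i < r)%N.
  move=> W; case: (ltngtP i r) => [ltir|ltri|/val_inj -> //]; first exact: W.
  by symmetry; apply: W.
have := ai; have := ar; rewrite !ascentE => /andP[ltr wr] /andP[lti wi].
have leni := swap_pos_length lti wi; have lenr := swap_pos_length ltr wr.
have vi := nextoK lti; have vr := nextoK ltr.
have d (a b : 'I_n) : a != b :> nat -> a != b by apply: contraNneq => ->.
have [ltir1|leri1] := ltnP i.+1 r.
  have air : ascent (swap_pos w r) i.
    by rewrite ascentE lti !swap_posE /simple_refl !tpermD //; apply: d; rewrite ?vi ?vr; lia.
  have ari : ascent (swap_pos w i) r.
    by rewrite ascentE ltr !swap_posE /simple_refl !tpermD //; apply: d; rewrite ?vi ?vr; lia.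
  rewrite (IH _ _ _ air) ?lenr // (IH _ _ _ ari) ?leni // -(@op_comm i r) //.
  by rewrite /swap_pos !mulgA (simple_refl_comm lti ltr ltir1).
have er : r = nexto i by apply: val_inj; rewrite /= vi; lia.
have lti2 : (i.+2 < n)%N by rewrite -vi -er.
set k := nexto r in wr vr; rewrite -er in wi.
have ir : i != r by apply: d; lia.
have rk : r != k by apply: d; lia.
have ik : i != k by apply: d; lia.
have tir : (tperm i r i = r) * (tperm i r r = i) * (tperm i r k = k).
  by rewrite tpermL tpermR tpermD.
have trk : (tperm r k i = i) * (tperm r k r = k) * (tperm r k k = r).
  by rewrite tpermL tpermR tpermD // eq_sym.
have Ei v l : swap_pos v i l = v (tperm i r l) by rewrite swap_posE /simple_refl -er.
have Er v l : swap_pos v r l = v (tperm r k l) by rewrite swap_posE.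
have wik := ltn_trans wi wr.
have air : ascent (swap_pos w r) i by rewrite ascentE lti -er !Er !trk.
have ari : ascent (swap_pos w i) r by rewrite ascentE ltr -/k !Ei !tir.
have lenri := eqP air; have lenir := eqP ari.
have a3 : ascent (swap_pos (swap_pos w r) i) r.
  by rewrite ascentE ltr -/k !(Ei, tir) !(Er, trk).
have a4 : ascent (swap_pos (swap_pos w i) r) i.
  by rewrite ascentE lti -er !(Er, trk) !(Ei, tir).
rewrite (IH _ _ _ air) ?lenr // (IH _ _ _ a3) ?lenri ?lenr; last by lia.
rewrite (IH _ _ _ ari) ?leni // (IH _ _ _ a4) ?lenir ?leni; last by lia.
have := @op_braid i; rewrite -er => <- //; congr (op _ (op _ (op _ (G _)))).
by have := simple_refl_braid lti2; rewrite /= -er /swap_pos !mulgA => ->.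
Qed.

End ChoiceIndependence.

End Permutations.

(** * Double Grothendieck polynomials *)

Section BraidRelations.
Variables (A : idomainType) (s t : {rmorphism A -> A}) (p q : A -> A).

Lemma demazure_comm a b c d f :
  a - b != 0 -> c - d != 0 ->
  s c = c -> s d = d -> t a = a -> t b = b -> (forall g, s (t g) = t (s g)) ->
  (forall g, p g * (a - b) = (1 - b) * g - (1 - a) * s g) ->
  (forall g, q g * (c - d) = (1 - d) * g - (1 - c) * t g) ->
  p (q f) = q (p f).
Proof.
move=> nab ncd sc sd ta tb st hp hq.
apply: (mulIf nab); apply: (mulIf ncd).
have e1 := congr1 s (hq f); have e2 := congr1 t (hp f).
rewrite !(rmorphM, rmorphB, rmorph1) /= ?sc ?sd in e1.
rewrite !(rmorphM, rmorphB, rmorph1) /= ?ta ?tb in e2.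
rewrite hp [RHS]mulrAC hq.
have -> : ((1 - b) * q f - (1 - a) * s (q f)) * (c - d) =
   (1 - b) * (q f * (c - d)) - (1 - a) * (s (q f) * (c - d)) by ring.
have -> : ((1 - d) * p f - (1 - c) * t (p f)) * (a - b) =
   (1 - d) * (p f * (a - b)) - (1 - c) * (t (p f) * (a - b)) by ring.
by rewrite hp hq e1 e2 st; ring.
Qed.

Lemma demazure_braid a b c f :
  a - b != 0 -> b - c != 0 -> a - c != 0 ->
  s a = b -> s b = a -> s c = c -> t a = a -> t b = c -> t c = b ->
  (forall g, s (s g) = g) -> (forall g, t (t g) = g) ->
  (forall g, s (t (s g)) = t (s (t g))) ->
  (forall g, p g * (a - b) = (1 - b) * g - (1 - a) * s g) ->
  (forall g, q g * (b - c) = (1 - c) * g - (1 - b) * t g) ->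
  p (q (p f)) = q (p (q f)).
Proof.
move=> nab nbc nac sa sb sc ta tb tc ss tt sts hp hq.
have e1 : q (p f) * (b - c) * (a - b) * (a - c) =
    (1 - c) * (a - c) * ((1 - b) * f - (1 - a) * s f)
    - (1 - b) * (a - b) * ((1 - c) * t f - (1 - a) * t (s f)).
  have e := congr1 t (hp f).
  rewrite !(rmorphM, rmorphB, rmorph1) /= ?ta ?tb in e.
  by rewrite hq -hp -e; ring.
have e2 : p (q f) * (a - b) * (b - c) * (a - c) =
    (1 - b) * (a - c) * ((1 - c) * f - (1 - b) * t f)
    - (1 - a) * (b - c) * ((1 - c) * s f - (1 - a) * s (t f)).
  have e := congr1 s (hq f).
  rewrite !(rmorphM, rmorphB, rmorph1) /= ?sb ?sc in e.
  by rewrite hp -hq -e; ring.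
have e1' := congr1 s e1; have e2' := congr1 t e2.
rewrite !(rmorphM, rmorphB, rmorph1) /= ?sa ?sb ?sc ?ss in e1'.
rewrite !(rmorphM, rmorphB, rmorph1) /= ?ta ?tb ?tc ?tt in e2'.
have e3 : p (q (p f)) * (a - b) * ((b - c) * (a - b) * (a - c)) =
  (1 - b) * (q (p f) * (b - c) * (a - b) * (a - c))
  + (1 - a) * (s (q (p f)) * (a - c) * (b - a) * (b - c)) by rewrite hp; ring.
have e4 : q (p (q f)) * (b - c) * ((b - c) * (a - b) * (a - c)) =
  (1 - c) * (p (q f) * (a - b) * (b - c) * (a - c))
  + (1 - b) * (t (p (q f)) * (a - c) * (c - b) * (a - b)) by rewrite hq; ring.
rewrite e1 e1' in e3; rewrite e2 e2' -sts in e4.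
apply: (mulIf nab); apply: (mulIf nbc).
have nD : (b - c) * (a - b) * (a - c) != 0 by rewrite !mulf_neq0.
apply: (mulIf nD); rewrite [LHS]mulrAC e3 -[RHS]mulrA [RHS]mulrAC.
have -> : q (p (q f)) * ((b - c) * ((b - c) * (a - b) * (a - c))) * (a - b) =
 q (p (q f)) * (b - c) * ((b - c) * (a - b) * (a - c)) * (a - b) by ring.
by rewrite e4; ring.
Qed.

End BraidRelations.

Section DividedDifference.
Variables (n : nat) (R : idomainType).
Implicit Types (i j : 'I_n) (f g : {mpoly R[n]}).

Definition srefl i f : {mpoly R[n]} := msym (simple_refl i) f.

Lemma ddiff_subproof i f : exists g, g * ('X_i - 'X_(nexto i)) == f - srefl i f.
Proof.
pose P f := exists g, g * ('X_i - 'X_(nexto i)) = f - srefl i f.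
suff: P f by case=> g <-; exists g.
have PM p q : P p -> P q -> P (p * q).
  case=> g Hg [h Hh]; exists (g * q + srefl i p * h).
  rewrite mulrDl -mulrA (mulrC q) mulrA Hg -mulrA Hh.
  by rewrite /srefl msymM mulrBl mulrBr addrA subrK.
have PD p q : P p -> P q -> P (p + q).
  case=> g Hg [h Hh]; exists (g + h).
  by rewrite mulrDl Hg Hh /srefl msymD opprD addrACA.
have P1 : P 1 by exists 0; rewrite mul0r /srefl msym1 subrr.
have P0 : P 0 by exists 0; rewrite mul0r /srefl msym0 subrr.
have PZ c p : P p -> P (c *: p).
  by case=> g Hg; exists (c *: g); rewrite -scalerAl Hg /srefl msymZ scalerBr.
have PX j : P 'X_j.
  rewrite /P /srefl /msym mmapX mmap1U /simple_refl.
  case: tpermP => [->|->|_ _].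
  - by exists 1; rewrite mul1r.
  - by exists (-1); rewrite mulN1r opprB.
  - by exists 0; rewrite mul0r subrr.
clearbody P.
have PXm m : P 'X_[m].
  rewrite (mpolyXE_id _ m); elim/big_ind: _ => // j _.
  by elim: (m j) => [|k IH]; rewrite ?expr0 // exprS; apply: PM.
by elim/mpolyind: f => [|c m p _ _ IH]; last by apply: PD => //; apply: PZ.
Qed.

(** The exact quotient of [f - s_i f] by [x_i - x_(i+1)], for [i] not the last index. *)
Definition ddiff i f : {mpoly R[n]} := xchoose (ddiff_subproof i f).

Definition isobaric i f : {mpoly R[n]} := ddiff i ((1 - 'X_(nexto i)) * f).

Lemma isobaricE i f : (i.+1 < n)%N ->
  isobaric i f * ('X_i - 'X_(nexto i)) =
    (1 - 'X_(nexto i)) * f - (1 - 'X_i) * srefl i f.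
Proof.
move=> lti; rewrite /isobaric /ddiff (eqP (xchooseP (ddiff_subproof _ _))).
by rewrite /srefl msymM msymB msym1 /msym mmapX mmap1U /simple_refl tpermR.
Qed.

Lemma sreflX i k : srefl i 'X_k = 'X_(simple_refl i k).
Proof. by rewrite /srefl /msym mmapX mmap1U. Qed.

Lemma sreflK i f : srefl i (srefl i f) = f.
Proof. by rewrite /srefl -msymMm /simple_refl tperm2 msym1m. Qed.

Lemma mpolyXB_neq0 i j : i != j :> nat -> 'X_i - 'X_j != 0 :> {mpoly R[n]}.
Proof.
move=> ne; rewrite subr_eq0; apply: contra ne => /eqP/(congr1 (mcoeff U_(i)%MM)).
rewrite !mcoeffX eqxx eq_mnm1; case: (j =P i) => [->|_ /eqP]; first by rewrite eqxx.
by rewrite oner_eq0.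
Qed.

Lemma isobaric_comm i j f : (i.+1 < n)%N -> (j.+1 < n)%N -> (i.+1 < j)%N ->
  isobaric i (isobaric j f) = isobaric j (isobaric i f).
Proof.
move=> lti ltj ltij.
have vi := nextoK lti; have vj := nextoK ltj.
have d (a b : 'I_n) : a != b :> nat -> a != b by apply: contraNneq => ->.
pose s : {rmorphism {mpoly R[n]} -> {mpoly R[n]}} := msym (simple_refl i).
pose t : {rmorphism {mpoly R[n]} -> {mpoly R[n]}} := msym (simple_refl j).
apply: (@demazure_comm _ s t _ _ 'X_i 'X_(nexto i) 'X_j 'X_(nexto j)).
- by apply: mpolyXB_neq0; lia.
- by apply: mpolyXB_neq0; lia.
- by rewrite [LHS]sreflX /simple_refl tpermD //; apply: d; rewrite ?vi ?vj; lia.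
- by rewrite [LHS]sreflX /simple_refl tpermD //; apply: d; rewrite ?vi ?vj; lia.
- by rewrite [LHS]sreflX /simple_refl tpermD //; apply: d; rewrite ?vi ?vj; lia.
- by rewrite [LHS]sreflX /simple_refl tpermD //; apply: d; rewrite ?vi ?vj; lia.
- move=> g; rewrite -[LHS]/(srefl i (srefl j g)) -[RHS]/(srefl j (srefl i g)).
  by rewrite /srefl -!msymMm (simple_refl_comm lti ltj).
- by move=> g; apply: isobaricE.
- by move=> g; apply: isobaricE.
Qed.

Lemma isobaric_braid i f : (i.+2 < n)%N -> let j := nexto i in
  isobaric i (isobaric j (isobaric i f)) = isobaric j (isobaric i (isobaric j f)).
Proof.
move=> lti j; have lti' : (i.+1 < n)%N by lia.
have vj : j = i.+1 :> nat by apply: nextoK.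
have ltj : (j.+1 < n)%N by rewrite vj.
have vk : nexto j = i.+2 :> nat by rewrite nextoK vj.
have d (a b : 'I_n) : a != b :> nat -> a != b by apply: contraNneq => ->.
pose s : {rmorphism {mpoly R[n]} -> {mpoly R[n]}} := msym (simple_refl i).
pose t : {rmorphism {mpoly R[n]} -> {mpoly R[n]}} := msym (simple_refl j).
apply: (@demazure_braid _ s t _ _ 'X_i 'X_j 'X_(nexto j)).
- by apply: mpolyXB_neq0; lia.
- by apply: mpolyXB_neq0; lia.
- by apply: mpolyXB_neq0; lia.
- by rewrite [LHS]sreflX /simple_refl tpermL.
- by rewrite [LHS]sreflX /simple_refl tpermR.
- by rewrite [LHS]sreflX /simple_refl -/j tpermD //; apply: d; rewrite ?vk; lia.
- by rewrite [LHS]sreflX /simple_refl -/j tpermD //; apply: d; rewrite ?vk; lia.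
- by rewrite [LHS]sreflX /simple_refl tpermL.
- by rewrite [LHS]sreflX /simple_refl tpermR.
- by move=> g; apply: sreflK.
- by move=> g; apply: sreflK.
- move=> g; rewrite -[LHS]/(srefl i (srefl j (srefl i g))).
  rewrite -[RHS]/(srefl j (srefl i (srefl j g))) /srefl -!msymMm !mulgA.
  by rewrite (simple_refl_braid lti).
- by move=> g; apply: isobaricE.
- by move=> g; apply: isobaricE.
Qed.

End DividedDifference.

(** Polynomials in [x_1 .. x_n] with coefficients in [Z[y_1 .. y_n]]. *)
Notation dpoly n := {mpoly {mpoly int[n]}[n]}.

(** [x_t] and [y_k], with the junk value 0 if the index is not in [1 .. n]. *)
Definition xvar n (t : nat) : dpoly n :=
  if t is t'.+1 then oapp (fun i : 'I_n => 'X_i) 0 (insub t') else 0.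

Definition yvar n (k : nat) : dpoly n :=
  if k is k'.+1 then oapp (fun i : 'I_n => ('X_i)%:MP) 0 (insub k') else 0.

Definition oplus (R : pzRingType) (a b : R) : R := a + b - a * b.
Notation "a ⊕ b" := (oplus a b) (at level 50, left associativity) : ring_scope.

Section Grothendieck.
Variable n : nat.
Implicit Types (w : 'S_n) (i : 'I_n).

Definition groth_longest : dpoly n :=
  \prod_(i < n) \prod_(j < n | (i.+1 + j.+1 <= n)%N) (xvar n i.+1 ⊕ yvar n j.+1).

(** The result does not depend on the ascent picked at each step ([groth_ascent]), and
    the values 0 are never reached: only [longest] has no ascent ([longest_ascent]), and
    [n ^ 2 - perm_length w] bounds the number of steps. *)
Fixpoint groth_rec (k : nat) w : dpoly n :=
  if w == longest n then groth_longest
  else if k is k'.+1 then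
    if [pick i | ascent w i] is Some i then isobaric i (groth_rec k' (swap_pos w i))
    else 0
  else 0.

Definition groth w : dpoly n := groth_rec (n ^ 2 - perm_length w) w.

Lemma groth_longestE : groth (longest n) = groth_longest.
Proof. by rewrite /groth; case: (_ - _)%N => [|k] /=; rewrite eqxx. Qed.

Lemma groth_pick w i : ascent w i ->
  exists2 r, ascent w r & groth w = isobaric r (groth (swap_pos w r)).
Proof.
move=> ai; rewrite /groth.
have lenw j : ascent w j ->
    (n ^ 2 - perm_length w = (n ^ 2 - perm_length (swap_pos w j)).+1)%N.
  move/eqP=> lenj; have := max_card (mem (inversions (swap_pos w j))).
  by rewrite card_prod card_ord -/(perm_length _) lenj; lia.
rewrite (lenw i ai) /=; have [wl|_] := eqVneq w (longest n).
  by rewrite wl longestN_ascent in ai.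
case: pickP => [r ar|/(_ i)]; last by rewrite ai.
have [->] : (n ^ 2 - perm_length (swap_pos w i)).+1 =
    (n ^ 2 - perm_length (swap_pos w r)).+1 by rewrite -!lenw.
by exists r; [exact: ar | reflexivity].
Qed.

Lemma groth_ascent w i : ascent w i -> groth w = isobaric i (groth (swap_pos w i)).
Proof.
move: w i; apply: ascent_independence => [i j a|i a|w i]; last exact: groth_pick.
- exact: isobaric_comm.
- exact: isobaric_braid.
Qed.

End Grothendieck.

(** * Rothe tableaux *)

Section Tableaux.
Variable n : nat.
Implicit Types (w : 'S_n) (B C : 'I_n * 'I_n) (f : 'I_n -> 'I_n.+1).

Definition rothe w : {set 'I_n * 'I_n} :=
  [set B : 'I_n * 'I_n |
    (B.2 < w B.1)%N && [exists h : 'I_n, (B.1 < h)%N && (w h == B.2)]].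

Definition rothe_rank w B : nat :=
  #|[set k : 'I_n | ((B.1, k) \in rothe w) && (k <= B.2)%N]|.

(** Fillings of the grid by sets of integers in [0 .. n], the value being [set0] at the
    squares outside the diagram.  As flags are bounded by [n], entries above [n] cannot
    occur in a flagged tableau. *)
Definition filling := {ffun 'I_n * 'I_n -> {set 'I_n.+1}}.
Implicit Types (S T : filling).

Definition fills w T : bool :=
  [forall B, if B \in rothe w then (T B != set0) && (ord0 \notin T B) else T B == set0].

Definition rothe_tableau w T : bool :=
  [&& fills w T,
      [forall B in rothe w, #|T B| == 1%N],
      [forall B in rothe w, forall C in rothe w, (B.1 == C.1) && (B.2 < C.2)%N ==>
         [forall s in T B, forall t in T C, (t <= s)%N]]
    & [forall B in rothe w, forall C in rothe w, (B.2 == C.2) && (B.1 < C.1)%N ==>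
         [forall s in T B, forall t in T C, (s < t)%N]]].

Definition limit_tableau w T : bool :=
  fills w T && [exists S, rothe_tableau w S && [forall B in rothe w, S B \subset T B]].

Definition flagged w f T : bool :=
  [forall B in rothe w, forall t in T B, (t <= f B.1)%N].

Definition SRT w f : {set filling} := [set T | rothe_tableau w T && flagged w f T].

Definition LSVRT w f : {set filling} := [set T | limit_tableau w T && flagged w f T].

(** The flag [(1, 2, .., n)]. *)
Definition flag0 (i : 'I_n) : 'I_n.+1 := lift ord0 i.

Definition SRT_entries w f B : {set 'I_n.+1} := \bigcup_(T in SRT w f) T B.

Definition replace T B (m : 'I_n.+1) : filling :=
  [ffun C => if C == B then [set m] else T C].

Definition larger_entries w f T B : {set 'I_n.+1} :=
  [set m : 'I_n.+1 | [forall t in T B, (t < m)%N] && (replace T B m \in SRT w f)].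

(** [x_t ⊕ y_(m_ij + i - t)] and [(1 - x_t) (1 - y_(m_ij + i - t))]; the 1-based row
    of [B] is [B.1.+1]. *)
Definition entry_weight w B (t : nat) : dpoly n :=
  xvar n t ⊕ yvar n (rothe_rank w B + B.1.+1 - t).

Definition coentry_weight w B (t : nat) : dpoly n :=
  (1 - xvar n t) * (1 - yvar n (rothe_rank w B + B.1.+1 - t)).

End Tableaux.

(* Main.v *)
Require Import Defs.
From HB Require Import structures.
From mathcomp Require Import all_boot all_order all_algebra all_fingroup.
From mathcomp Require Import mpoly zify ring.

(** Put [a_(r,c) = (1 - x_r) (1 - y_c)], so that [x_r ⊕ y_c = 1 - a_(r,c)], and let every
    cell [(r,c)] of the staircase [r + c <= n] be a crossing, labelled [s_(r+c-1)],
    independently and with formal probability [x_r ⊕ y_c].  Reading the rows from top to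
    bottom and each of them from right to left, [groth w] is the probability that the
    Demazure product of the crossings is at least [w]: the Yang-Baxter equation for two
    consecutive rows gives the recursion by isobaric divided differences.

    Likewise, if each pair (square of [D(w)], possible entry) is selected independently with
    the corresponding probability, both sums of the theorem are the probability that the
    selection contains a single-valued tableau.  The first one partitions this event
    according to the selected admissible entries, the second one according to the largest
    tableau contained in the selection, which exists because tableaux are closed under
    pointwise maximum.

    The two probabilities agree because they satisfy the same recursion on the cells.
    Conditioning on the crossing in the first cell replaces [w] by [s_k w] when this is
    shorter.  As [w] avoids 1432, either both terms vanish or all the values standing before
    [k + 1] are less than [k]; in the latter case [D(s_k w)] is [D(w)] minus one square with
    the same relations between the remaining squares, and the recursion corresponds to
    conditioning on the selection of the smallest entry in that square. *)

Set Implicit Arguments.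
Unset Strict Implicit.
Unset Printing Implicit Defensive.

Import GRing.Theory.
Local Open Scope ring_scope.

(** * Random subsets of a finite set *)

Section RandomSubsets.
Variables (R : comNzRingType) (V : finType).
Implicit Types (p : V -> R) (Z A C : {set V}) (phi : pred {set V}).

Definition set_weight p Z : R := \prod_v (if v \in Z then p v else 1 - p v).

Definition prob p phi : R := \sum_(Z | phi Z) set_weight p Z.

Lemma eq_prob p phi psi : phi =1 psi -> prob p phi = prob p psi.
Proof. by move=> e; apply: eq_bigl. Qed.

(** Distinct elements are selected independently: expanding the product of [F v + G v] gives one
    term per subset, and an element outside [A] and [C] contributes [p v + (1 - p v) = 1]. *)
Lemma prob_cylinder p A C : [disjoint A & C] ->
  prob p (fun Z => (A \subset Z) && [disjoint C & Z]) =
    \prod_(v in A) p v * \prod_(v in C) (1 - p v).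
Proof.
move=> dAC.
pose F v := if v \in C then 0 else p v.
pose G v : R := if v \in A then 0 else 1 - p v.
transitivity (\prod_v (F v + G v)); last first.
  rewrite [X in X * _]big_mkcond [X in _ * X]big_mkcond -big_split.
  apply: eq_bigr => v _; rewrite /F /G /=.
  case: (boolP (v \in A)) => vA; first by rewrite (disjointFr dAC vA) addr0 mulr1.
  by case: (v \in C); rewrite ?add0r ?mul1r // addrC subrK.
rewrite bigA_distr /prob big_mkcond; apply: eq_bigr => Z _.
case: ifP => [/andP[/subsetP sAZ dCZ]|].
  apply: eq_bigr => v _; rewrite /F /G.
  case: (boolP (v \in Z)) => vZ; first by rewrite (disjointFl dCZ vZ).
  by case: ifP => // /sAZ; rewrite (negbTE vZ).
move/negbT; rewrite negb_and => /orP[/subsetPn[v vA vZ]|].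
  by rewrite (bigD1 v) //= (negbTE vZ) /G vA mul0r.
rewrite -setI_eq0 => /set0Pn[v]; rewrite inE => /andP[vC vZ].
by rewrite (bigD1 v) //= vZ /F vC mul0r.
Qed.

Lemma prob_true p : prob p xpredT = 1.
Proof.
rewrite (@eq_prob p _ (fun Z => (set0 \subset Z) && [disjoint set0 & Z])).
  by rewrite prob_cylinder ?big_set0 ?mulr1 // -setI_eq0 set0I.
by move=> Z; rewrite sub0set -setI_eq0 set0I eqxx.
Qed.

Lemma prob_false p : prob p xpred0 = 0.
Proof. exact: big_pred0_eq. Qed.

(** Subsets are paired as [Z] and [u |: Z] with [u] outside [Z]; their weights differ only in the
    factor at [u]. *)
Lemma prob_condition p phi u :
  prob p phi = p u * prob p (fun Z => phi (u |: Z))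
               + (1 - p u) * prob p (fun Z => phi (Z :\ u)).
Proof.
have split F : \sum_Z F Z = \sum_(Z : {set V} | u \notin Z) (F Z + F (u |: Z)) :> R.
  rewrite (bigID (fun Z : {set V} => u \in Z)) /= addrC big_split /=; congr (_ + _).
  rewrite (reindex_onto (fun Z => u |: Z) (fun Z => Z :\ u)) /=.
    apply: eq_bigl => Z; rewrite setU11 /=; apply/eqP/idP => [<-|uZ].
      by rewrite !inE eqxx.
    by rewrite setU1K.
  by move=> Z uZ; rewrite setD1K.
rewrite /prob !(big_mkcond (fun Z => phi _)) /= !split !mulr_sumr -big_split /=.
apply: eq_bigr => Z uZ.
have wtU Z' : set_weight p Z' =
    (if u \in Z' then p u else 1 - p u) *
    \prod_(v | v != u) (if v \in Z' then p v else 1 - p v).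
  by rewrite /set_weight (bigD1 u).
have -> : set_weight p (u |: Z) = p u * \prod_(v | v != u) (if v \in Z then p v else 1 - p v).
  rewrite wtU setU11; congr (_ * _); apply: eq_bigr => v vu.
  by rewrite !inE (negbTE vu).
rewrite wtU (negbTE uZ) setUA setUid (setU1K uZ).
have -> : Z :\ u = Z by apply/setDidPl; rewrite disjoint_sym disjoints1.
by case: (phi Z); case: (phi (u |: Z)); ring.
Qed.

Lemma prob_disjoint_union (I : finType) p phi (P : pred I) (c : I -> pred {set V}) :
  (forall Z, phi Z = [exists i, P i && c i Z]) ->
  (forall Z i j, P i -> P j -> c i Z -> c j Z -> i = j) ->
  prob p phi = \sum_(i | P i) prob p (c i).
Proof.
move=> phiE cuniq; rewrite /prob; under [RHS]eq_bigr do rewrite big_mkcond.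
rewrite exchange_big /= big_mkcond; apply: eq_bigr => Z _.
rewrite -big_mkcondr /= phiE.
case: existsP => [[i /andP[Pi ci]]|none].
  rewrite (big_pred1 i) // => j; apply/andP/eqP => [[Pj cj]|-> //].
  exact: cuniq cj ci.
by rewrite big_pred0 // => i; apply/negbTE/negP => Pc; case: none; exists i.
Qed.

End RandomSubsets.

Lemma prob_reindex (R : comNzRingType) (U V : finType) (s : U -> V) (p : V -> R) phi :
  bijective s ->
  prob p phi = prob (p \o s) (fun Z => phi (s @: Z)).
Proof.
move=> bs; have injs := bij_inj bs; have [s' sK s'K] := bs.
rewrite /prob (reindex (fun Z : {set U} => s @: Z)) /=.
  apply: eq_bigr => Z _; rewrite /set_weight (reindex s) /=; last first.
    by exists s' => ? _.
  by apply: eq_bigr => u _; rewrite mem_imset.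
exists (fun Z : {set V} => s' @: Z) => Z _; rewrite -imset_comp.
  by rewrite (eq_imset (g := id)) ?imset_id // => u /=.
by rewrite (eq_imset (g := id)) ?imset_id // => u /=.
Qed.

(** * Demazure products *)

Section DemazureProducts.
Variable n : nat.
Implicit Types (v w : 'S_n) (i j : 'I_n) (k l : nat).

(** Right and left multiplication by [s_k] whenever this decreases the length; [k] is
    0-based, and both maps are the identity if [k + 1 >= n]. *)
Definition rdem k w : 'S_n :=
  if insub k is Some i then if (w (nexto i) < w i)%N then swap_pos w i else w else w.

Definition ldem k w : 'S_n := ((rdem k w^-1)^-1)%g.

Lemma rdem_out k w : (n <= k.+1)%N -> rdem k w = w.
Proof.
move=> lenk; rewrite /rdem; case: insubP => // i _ ik.
by rewrite nexto_id ?ltnn // -leqNgt ik.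
Qed.

Lemma rdem_ord i w : rdem i w = if (w (nexto i) < w i)%N then swap_pos w i else w.
Proof. by rewrite /rdem valK. Qed.

(** Sorting two adjacent positions: in this form the 0-Hecke relations become identities between
    minima and maxima, checked position by position. *)
Lemma rdemE i j w x : j = i.+1 :> nat -> rdem i w x =
  (if x == i then minn (w i) (w j) else if x == j then maxn (w i) (w j) else w x) :> nat.
Proof.
move=> ij; have lti : (i.+1 < n)%N by rewrite -ij.
have -> : j = nexto i by apply: val_inj; rewrite /= nextoK.
rewrite rdem_ord; case: ltnP => ltw.
  rewrite swap_posE /simple_refl.
  have [->|xi] := eqVneq x i; first by rewrite tpermL; lia.
  by have [->|xj] := eqVneq x (nexto i); rewrite ?tpermR ?tpermD // 1?eq_sym //; lia.
by have [->|xi] := eqVneq x i; last have [->|//] := eqVneq x (nexto i); lia.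
Qed.

Lemma rdemK k w : rdem k (rdem k w) = rdem k w.
Proof.
have [lek|ltk] := leqP n k.+1; first by rewrite !rdem_out.
pose j := Ordinal ltk; pose i := Ordinal (ltnW ltk : (k < n)%N).
apply/permP => x; apply: val_inj.
rewrite -[k]/(i : nat) /= !(@rdemE i j) // !eqxx.
have -> : (j == i) = false by rewrite -val_eqE /=; lia.
by case: eqP => // _; [|case: eqP => // _]; lia.
Qed.

Lemma rdem_comm k l w : (k.+1 < l)%N -> rdem k (rdem l w) = rdem l (rdem k w).
Proof.
move=> ltkl; have [lel|ltl] := leqP n l.+1; first by rewrite !(rdem_out (k := l)).
have kn : (k.+1 < n)%N by lia.
pose j := Ordinal ltl; pose i := Ordinal (ltnW ltl : (l < n)%N).
pose j' := Ordinal kn; pose i' := Ordinal (ltnW kn : (k < n)%N).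
apply/permP => x; apply: val_inj.
rewrite -[k]/(i' : nat) -[l]/(i : nat) /= !(@rdemE i j) // !(@rdemE i' j') //.
rewrite !(@rdemE i j) // -!val_eqE /= ?eqxx.
have -> : (k == l) = false by lia.
have -> : (k.+1 == l) = false by lia.
have -> : (k == l.+1) = false by lia.
have -> : (k.+1 == l.+1) = false by lia.
have -> : (l == k) = false by lia.
have -> : (l.+1 == k) = false by lia.
have -> : (l == k.+1) = false by lia.
have -> : (l.+1 == k.+1) = false by lia.
by repeat case: eqP => ?; lia.
Qed.

Lemma rdem_braid k w :
  rdem k (rdem k.+1 (rdem k w)) = rdem k.+1 (rdem k (rdem k.+1 w)).
Proof.
have [lek|ltk] := leqP n k.+2; first by rewrite !(rdem_out (k := k.+1)) // rdemK.
pose i3 := Ordinal ltk; pose i2 := Ordinal (ltnW ltk); pose i1 := Ordinal (ltnW (ltnW ltk)).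
apply/permP => x; apply: val_inj.
rewrite -[k.+1]/(i2 : nat) -[k in rdem k _]/(i1 : nat) /=.
rewrite !(@rdemE i1 i2, @rdemE i2 i3) // -!val_eqE /= ?eqxx.
have -> : (k == k.+1) = false by lia.
have -> : (k.+1 == k) = false by lia.
have -> : (k == k.+2) = false by lia.
have -> : (k.+2 == k) = false by lia.
have -> : (k.+2 == k.+1) = false by lia.
by repeat case: eqP => ?; lia.
Qed.

Lemma ldemK k w : ldem k (ldem k w) = ldem k w.
Proof. by rewrite /ldem invgK rdemK. Qed.

Lemma ldem_comm k l w : (k.+1 < l)%N -> ldem k (ldem l w) = ldem l (ldem k w).
Proof. by move=> ltkl; rewrite /ldem !invgK rdem_comm. Qed.

Lemma ldem_braid k w :
  ldem k (ldem k.+1 (ldem k w)) = ldem k.+1 (ldem k (ldem k.+1 w)).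
Proof. by rewrite /ldem !invgK rdem_braid. Qed.

Lemma ldem_out k w : (n <= k.+1)%N -> ldem k w = w.
Proof. by move=> lenk; rewrite /ldem rdem_out // invgK. Qed.

Lemma ldem_ord i w :
  ldem i w = if (w^-1%g (nexto i) < w^-1%g i)%N then (w * simple_refl i)%g else w.
Proof.
rewrite /ldem rdem_ord; case: ifP => _; last by rewrite invgK.
by rewrite /swap_pos invMg invgK /simple_refl tpermV.
Qed.

Lemma simple_refl_lt i (x y : 'I_n) : (i.+1 < n)%N ->
  (simple_refl i x < simple_refl i y)%N =
  if (x == i) && (y == nexto i) || (x == nexto i) && (y == i) then (y < x)%N
  else (x < y)%N.
Proof.
move=> lti; have vi := nextoK lti; rewrite /simple_refl -!val_eqE /= vi.
case: tpermP => [->|->|/eqP + /eqP]; case: tpermP => [->|->|/eqP + /eqP];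
  rewrite -?val_eqE /= ?vi; case: ifP; lia.
Qed.

(** The two actions interfere only if positions [i], [i + 1] carry the values [j], [j + 1] in some
    order. Then both multiplications and both descent tests coincide; otherwise neither
    multiplication changes the other test. *)
Lemma rdem_ldem k l w : rdem k (ldem l w) = ldem l (rdem k w).
Proof.
have [lek|ltk] := leqP n k.+1; first by rewrite !(rdem_out (k := k)).
have [lel|ltl] := leqP n l.+1; first by rewrite !(ldem_out (k := l)).
pose i := Ordinal (ltnW ltk); pose j := Ordinal (ltnW ltl).
have lti : (i.+1 < n)%N by []. have ltj : (j.+1 < n)%N by [].
rewrite -[k]/(i : nat) -[l]/(j : nat) !(rdem_ord, ldem_ord).
have xi : (simple_refl i)^-1%g = simple_refl i by rewrite /simple_refl tpermV.
have inv_swap x : ((swap_pos w i)^-1 x = simple_refl i (w^-1 x))%g.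
  by rewrite /swap_pos invMg permM xi.
have ne : w^-1%g (nexto j) != w^-1%g j.
  by rewrite (inj_eq perm_inj) -val_eqE /= (nextoK ltj) /=; lia.
have e1 : (w^-1%g (nexto j) == i) = (w i == nexto j).
  by apply/eqP/eqP => [<-|<-]; rewrite ?permKV ?permK.
have e2 : (w^-1%g (nexto j) == nexto i) = (w (nexto i) == nexto j).
  by apply/eqP/eqP => [<-|<-]; rewrite ?permKV ?permK.
have e3 : (w^-1%g j == i) = (w i == j).
  by apply/eqP/eqP => [<-|<-]; rewrite ?permKV ?permK.
have e4 : (w^-1%g j == nexto i) = (w (nexto i) == j).
  by apply/eqP/eqP => [<-|<-]; rewrite ?permKV ?permK.
have R0 : (swap_pos w i * simple_refl j = swap_pos (w * simple_refl j) i)%g.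
  by rewrite /swap_pos mulgA.
case: (boolP ((w i == nexto j) && (w (nexto i) == j) || (w i == j) && (w (nexto i) == nexto j))).
  move=> same.
  have sw : (swap_pos w i = w * simple_refl j)%g.
    apply/permP => x; rewrite swap_posE permM /simple_refl.
    case: tpermP => [->|->|xi1 xi2].
    - by case/orP: same => /andP[/eqP-> /eqP->]; rewrite ?tpermL ?tpermR.
    - by case/orP: same => /andP[/eqP-> /eqP->]; rewrite ?tpermL ?tpermR.
    rewrite tpermD //; apply/eqP => E.
      by case/orP: same => /andP[/eqP E1 /eqP E2];
        [apply: xi2; apply: (@perm_inj _ w) | apply: xi1; apply: (@perm_inj _ w)]; congruence.
    by case/orP: same => /andP[/eqP E1 /eqP E2];
        [apply: xi1; apply: (@perm_inj _ w) | apply: xi2; apply: (@perm_inj _ w)]; congruence.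
  have eqc : (w^-1%g (nexto j) < w^-1%g j)%N = (w (nexto i) < w i)%N.
    case/orP: same => /andP[/eqP E1 /eqP E2].
      have -> : w^-1%g (nexto j) = i by rewrite -E1 permK.
      have -> : w^-1%g j = nexto i by rewrite -E2 permK.
      by rewrite E1 E2 (nextoK lti) (nextoK ltj); lia.
    have -> : w^-1%g (nexto j) = nexto i by rewrite -E2 permK.
    have -> : w^-1%g j = i by rewrite -E1 permK.
    by rewrite E1 E2 (nextoK lti) (nextoK ltj); lia.
  rewrite eqc; case cw: (w (nexto i) < w i)%N; last by rewrite eqc cw.
  rewrite -sw !swap_posE !inv_swap simple_refl_lt // e1 e2 e3 e4.
  rewrite [(w (nexto i) == nexto j) && _]andbC same /simple_refl tpermL tpermR.
  have -> : (w i < w (nexto i))%N = false by lia.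
  suff -> : (w^-1%g j < w^-1%g (nexto j))%N = false by [].
  by move: eqc; rewrite cw; lia.
move=> diff.
have c1 : ((w * simple_refl j)%g (nexto i) < (w * simple_refl j)%g i)%N = (w (nexto i) < w i)%N.
  by rewrite !permM simple_refl_lt // andbC [_ && (w i == j)]andbC (negbTE diff).
have c2 : ((swap_pos w i)^-1%g (nexto j) < (swap_pos w i)^-1%g j)%N =
    (w^-1%g (nexto j) < w^-1%g j)%N.
  rewrite !inv_swap simple_refl_lt // e1 e2 e3 e4.
  rewrite [(w (nexto i) == nexto j) && _]andbC.
  by rewrite (negbTE diff).
by case C1: (w (nexto i) < w i)%N; case C2: (w^-1%g (nexto j) < w^-1%g j)%N;
  rewrite ?c1 ?c2 ?C1 ?C2 ?R0.
Qed.

(** On either side exactly the identity and [s_k] are sent to the identity. This allows a left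
    factor to be traded for a right one at the bottom of a pipe dream. *)
Lemma ldem_eq1 k : forall w, (ldem k w == 1%g) = (rdem k w == 1%g).
Proof.
move=> w; have [lek|ltk] := leqP n k.+1; first by rewrite ldem_out ?rdem_out.
pose i := Ordinal (ltnW ltk); have lti : (i.+1 < n)%N by [].
have P u : (rdem i u == 1%g) = (u == 1%g) || (u == simple_refl i).
  rewrite rdem_ord; have [->|ns] := eqVneq u (simple_refl i).
    rewrite /simple_refl tpermL tpermR nextoK // leqnn orbT /swap_pos.
    by rewrite /simple_refl tperm2 eqxx.
  rewrite orbF; case: ifP => // c; apply/eqP/eqP.
    move=> E; case/eqP: ns; rewrite -[u](swap_posK _ i) E /swap_pos mulg1 //.
  by move=> E; rewrite E !perm1 nextoK // ltnNge leqnSn in c.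
rewrite -[k]/(i : nat) P /ldem -[LHS](inj_eq (can_inj (@invgK _))) invgK invg1 P.
rewrite -(inj_eq (can_inj (@invgK _))) invgK invg1; congr (_ || _).
by rewrite -(inj_eq (can_inj (@invgK _))) invgK /simple_refl tpermV.
Qed.

End DemazureProducts.

(** * Pipe dreams *)

Section PipeDreams.
Variables (n : nat) (R : comNzRingType) (Y : nat -> R).
Implicit Types (v w : 'S_n) (Phi Psi : 'S_n -> R) (k l r c m : nat) (a b x z : R).

(** A cell labelled [s_k]: [a] weighs the absence of a crossing, [b] a crossing, after which the
    remaining cells only have to reach [ldem k v]. *)
Definition dop k a b Phi v : R := a * Phi v + b * Phi (ldem k v).

Definition rop k a b Phi v : R := a * Phi v + b * Phi (rdem k v).

(** Row [r] of the staircase, restricted to its cells [(r, c - 1), ..., (r, 0)]; the cell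
    [(r, j)] is a crossing [s_(r + j)] with probability [1 - x * Y j]. *)
Fixpoint pipe_row x r c Phi : 'S_n -> R :=
  if c is c'.+1 then dop (r + c') (x * Y c') (1 - x * Y c') (pipe_row x r c' Phi)
  else Phi.

(** The probability that the Demazure product of the last [m] rows is at least [v]. *)
Fixpoint pipe_poly (X : nat -> R) m : 'S_n -> R :=
  if m is m'.+1 then pipe_row (X (n - m)%N) (n - m) m' (pipe_poly X m')
  else fun v => (v == 1%g)%:R.

Lemma eq_dop k a b Phi Psi : Phi =1 Psi -> dop k a b Phi =1 dop k a b Psi.
Proof. by move=> e v; rewrite /dop !e. Qed.

Lemma eq_pipe_row x r c Phi Psi : Phi =1 Psi -> pipe_row x r c Phi =1 pipe_row x r c Psi.
Proof. by move=> e; elim: c => //= c IH; apply: eq_dop. Qed.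

Lemma dop_comm k l a b a' b' Phi : (k.+1 < l)%N ->
  dop k a b (dop l a' b' Phi) =1 dop l a' b' (dop k a b Phi).
Proof. by move=> ltkl v; rewrite /dop (ldem_comm v ltkl); ring. Qed.

Lemma dop_rop k l a b a' b' Phi :
  dop k a b (rop l a' b' Phi) =1 rop l a' b' (dop k a b Phi).
Proof. by move=> v; rewrite /dop /rop rdem_ldem; ring. Qed.

(** Yang-Baxter equation: moving an auxiliary crossing of total weight [z + (x - z) = x] past two
    cells of one column exchanges the row parameters [x] and [z]. *)
Lemma dop_braid k x y z Phi :
  dop k (x * y) (1 - x * y) (dop k.+1 (z * y) (1 - z * y) (dop k z (x - z) Phi)) =1
  dop k.+1 z (x - z) (dop k (z * y) (1 - z * y) (dop k.+1 (x * y) (1 - x * y) Phi)).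
Proof. by move=> v; rewrite /dop !ldem_braid !ldemK; ring. Qed.

Lemma dop_merge k x y z Phi v :
  dop k (x * y) (1 - x * y) (dop k z (x - z) Phi) v = x * dop k (z * y) (1 - z * y) Phi v.
Proof. by rewrite /dop ldemK; ring. Qed.

Lemma pipe_row_rop x r c l a b Phi :
  pipe_row x r c (rop l a b Phi) =1 rop l a b (pipe_row x r c Phi).
Proof.
elim: c => //= c IH v; rewrite (eq_dop _ _ _ IH); exact: dop_rop.
Qed.

Lemma pipe_row_scale x r c a Phi v :
  pipe_row x r c (fun u => a * Phi u) v = a * pipe_row x r c Phi v.
Proof. by elim: c v => //= c IH v; rewrite /dop !IH; ring. Qed.

Lemma pipe_row_dop_lt x r c l a b Phi : (l.+1 < r)%N ->
  pipe_row x r c (dop l a b Phi) =1 dop l a b (pipe_row x r c Phi).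
Proof.
move=> ltlr; elim: c => //= c IH v; rewrite (eq_dop _ _ _ IH).
by rewrite (@dop_comm l) //; lia.
Qed.

Lemma pipe_row_dop_gt x r c l a b Phi : (r + c < l)%N ->
  pipe_row x r c (dop l a b Phi) =1 dop l a b (pipe_row x r c Phi).
Proof.
elim: c => //= c IH lt_l v; rewrite -dop_comm; last by lia.
by apply: eq_dop; apply: IH; lia.
Qed.

(** One Yang-Baxter move per column carries the auxiliary crossing from the end of the two rows to
    their beginning, raising its label by one each time. *)
Lemma pipe_row_exchange x z r c Phi :
  pipe_row x r c (pipe_row z r.+1 c (dop r z (x - z) Phi)) =1
  dop (r + c) z (x - z) (pipe_row z r c (pipe_row x r.+1 c Phi)).
Proof.
(* A cell of the lower row commutes with the upper cells in the columns to its left, their labels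
   being smaller by at least two; this brings the two cells of a column together. *)
have swap (u v : R) c' Psi : pipe_row u r c' (dop (r.+1 + c') (v * Y c') (1 - v * Y c') Psi) =1
    dop (r.+1 + c') (v * Y c') (1 - v * Y c') (pipe_row u r c' Psi).
  by apply: pipe_row_dop_gt; lia.
elim: c => [|c IH] w; first by rewrite addn0.
rewrite /= addnS (eq_dop _ _ _ (swap _ _ _ _)) (eq_dop _ _ _ (eq_dop _ _ _ IH)).
rewrite addSn dop_braid; apply: eq_dop => {}w; apply: eq_dop => {}w.
by rewrite -addSn swap.
Qed.

(** The upper row of the staircase has one cell more, and by [dop_merge] this cell absorbs the
    auxiliary crossing. *)
Lemma pipe_rows_symmetric x z r c Phi v :
  pipe_row x r c.+1 (pipe_row z r.+1 c (dop r z (x - z) Phi)) v =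
  x * pipe_row z r c.+1 (pipe_row x r.+1 c Phi) v.
Proof. by rewrite /= (eq_dop _ _ _ (pipe_row_exchange _ _ _ _ _)) dop_merge. Qed.

(** The label [l] commutes with all labels of the last [m] rows, so the operator can be pushed to
    the bottom, where [ldem_eq1] identifies left and right. *)
Lemma pipe_poly_dop_rop X m l a b : (m <= n)%N -> (l.+1 < n - m)%N ->
  dop l a b (pipe_poly X m) =1 rop l a b (pipe_poly X m).
Proof.
elim: m => [|m IH] lem ltl v /=; first by rewrite /dop /rop ldem_eq1.
rewrite -pipe_row_dop_lt // -pipe_row_rop; apply: eq_pipe_row.
by apply: IH; lia.
Qed.

Lemma eq_pipe_poly X X' m : (forall r, (n - m <= r < n)%N -> X r = X' r) -> (m <= n)%N ->
  pipe_poly X m =1 pipe_poly X' m.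
Proof.
elim: m => //= m IH eX lem v; rewrite eX; last by lia.
by apply: eq_pipe_row; apply: IH => [r rP|]; [apply: eX; lia|lia].
Qed.

Definition swap_seq r (X : nat -> R) t : R :=
  if t == r then X r.+1 else if t == r.+1 then X r else X t.

(** At a descent [r] of [w] this is the recursion by isobaric divided differences, cleared of
    denominators. [rop r] passes through the rows above [r]; below the rows [r] and [r + 1] it
    becomes the auxiliary crossing that exchanges their parameters. *)
Lemma pipe_poly_swap X m r w : (m <= n)%N -> (n - m <= r)%N -> (r.+1 < n)%N ->
  X r.+1 * pipe_poly X m w + (X r - X r.+1) * pipe_poly X m (rdem r w) =
  X r * pipe_poly (swap_seq r X) m w.
Proof.
elim: m w => [|m IH] w lem lenr ltr; first by lia.
rewrite -[LHS]/(rop r (X r.+1) (X r - X r.+1) (pipe_poly X m.+1) w) /=.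
rewrite -pipe_row_rop; have [ltmr|lerm] := ltnP (n - m.+1) r.
  have -> : swap_seq r X (n - m.+1)%N = X (n - m.+1)%N.
    by rewrite /swap_seq !ifN_eq //; lia.
  rewrite -pipe_row_scale; apply: eq_pipe_row => u.
  by rewrite /rop IH //; lia.
have {lenr lerm} rE : (n - m.+1 = r)%N by lia.
case: m => [|m] in IH lem rE *; first by lia.
have r1E : (n - m.+1 = r.+1)%N by lia.
rewrite rE [pipe_poly X m.+1]/= [pipe_poly _ m.+1]/= r1E.
have -> : swap_seq r X r = X r.+1 by rewrite /swap_seq eqxx.
have -> : swap_seq r X r.+1 = X r by rewrite /swap_seq eqxx ifN_eq //; lia.
rewrite (eq_pipe_row _ _ _ (fun u => esym (pipe_row_rop _ _ _ _ _ _ _ u))).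
have rdE : rop r (X r.+1) (X r - X r.+1) (pipe_poly X m) =1
    dop r (X r.+1) (X r - X r.+1) (pipe_poly X m).
  by move=> u; rewrite pipe_poly_dop_rop //; lia.
rewrite (eq_pipe_row _ _ _ (eq_pipe_row _ _ _ rdE)).
rewrite pipe_rows_symmetric; congr (_ * _); apply: eq_pipe_row => u.
apply: eq_pipe_row; apply: eq_pipe_poly => [t|]; last by lia.
by rewrite /swap_seq; case: eqP => [|_]; [lia|case: eqP => //; lia].
Qed.

End PipeDreams.

(** * Left multiplication in terms of values *)

Section DemazureValues.
Variable n : nat.
Implicit Types (v w : 'S_n) (k l r c m : nat).

Lemma ldem_val k v (a b x : 'I_n) : v a = k.+1 :> nat -> v b = k :> nat ->
  ldem k v x = (if (a < b)%N then
     (if x == a then k else if x == b then k.+1 else v x) else v x) :> nat.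
Proof.
move=> va vb; have ltk : (k.+1 < n)%N by rewrite -va.
have ev : nexto (v b) = v a by apply: val_inj; rewrite /= nextoK ?vb // va.
have -> : ldem k v = ldem (v b) v by rewrite vb.
rewrite ldem_ord ev !permK; case: ifP => // ltab.
rewrite permM /simple_refl ev; have [->|xa] := eqVneq x a; first by rewrite tpermR vb.
have [->|xb] := eqVneq x b; first by rewrite tpermL va.
by rewrite tpermD // (inj_eq perm_inj) eq_sym.
Qed.

Lemma ldem_val_out k v (x : 'I_n) : v x != k :> nat -> v x != k.+1 :> nat ->
  ldem k v x = v x.
Proof.
move=> nk nk1; have [lek|ltk] := leqP n k.+1; first by rewrite ldem_out.
pose a := v^-1%g (Ordinal ltk); pose b := v^-1%g (Ordinal (ltnW ltk)).
apply: val_inj; rewrite /= (@ldem_val _ _ a b) ?permKV //.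
case: ifP => // _; rewrite !(eq_sym x) !(canF_eq (permKV v)) -!val_eqE /=.
by rewrite !(eq_sym _ (v x : nat)) (negbTE nk) (negbTE nk1).
Qed.

End DemazureValues.

(** * Vanishing criteria and the longest permutation *)

Section Vanishing.
Variables (n : nat) (R : comNzRingType) (X Y : nat -> R).
Implicit Types (v w : 'S_n) (Phi Psi : 'S_n -> R) (k l r c m : nat).

Lemma pipe_row_eq0 (x : R) r c Phi (P : pred 'S_n) :
  (forall v, P v -> Phi v = 0) ->
  (forall v c', (c' < c)%N -> P v -> P (ldem (r + c') v)) ->
  forall v, P v -> pipe_row Y x r c Phi v = 0.
Proof.
move=> P0; elim: c => [|c IH] Pstep v Pv /=; first exact: P0.
have {}IH : forall u, P u -> pipe_row Y x r c Phi u = 0.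
  by apply: IH => u c' ltc; apply: Pstep; lia.
by rewrite /dop !IH ?mulr0 ?addr0 //; apply: Pstep.
Qed.

(** The last [m] rows only move values from [n - m] on, so a smaller misplaced value stays misplaced
    and the identity is never reached. *)
Lemma pipe_poly_displaced m v (x : 'I_n) : (m <= n)%N ->
  (v x < n - m)%N -> v x != x -> pipe_poly Y X m v = 0.
Proof.
elim: m v => [|m IH] v lem ltx nx /=.
  by case: eqP => // v1; rewrite v1 perm1 eqxx in nx.
pose P (u : 'S_n) := u x == v x.
apply: (@pipe_row_eq0 _ _ _ _ P) => [u /eqP ux|u c ltc /eqP ux|]; last exact: eqxx.
  by apply: (IH u) => //; [lia | rewrite ux; lia | rewrite ux].
by rewrite /P ldem_val_out ?ux //; lia.
Qed.

(** The labels left in the row move only values up to [r + c], so [v r] stays in position [r]. The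
    value [r] is then misplaced at the end of the row, out of reach of the lower rows. *)
Lemma pipe_row_poly_eq0 m c v (r : 'I_n) : (m < n)%N -> r = (n - m.+1)%N :> nat ->
  (r + c < v r)%N -> pipe_row Y (X r) r c (pipe_poly Y X m) v = 0.
Proof.
move=> ltm rE ltc; pose P (u : 'S_n) := u r == v r.
apply: (@pipe_row_eq0 _ _ _ _ P) => [u /eqP ur|u c' ltc' /eqP ur|]; last exact: eqxx.
  apply: (@pipe_poly_displaced _ _ (u^-1%g r)); rewrite ?permKV; first by lia.
    by rewrite rE; lia.
  rewrite eq_sym (canF_eq (permKV u)) ur -val_eqE /=; lia.
by rewrite /P ldem_val_out ?ur //; lia.
Qed.

(** Every cell has to be a crossing: omitting one in row [r] leaves a value at position [r] that is
    too large for the rest of the row. *)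
Lemma pipe_poly_longest_rec m v : (m <= n)%N ->
  (forall i : 'I_n, (i < n - m)%N -> v i = i) ->
  (forall i j : 'I_n, (n - m <= i < j)%N -> (v j < v i)%N) ->
  pipe_poly Y X m v = \prod_(n - m <= i < n) \prod_(0 <= j < n - i.+1) (1 - X i * Y j).
Proof.
elim: m v => [|m IH] v lem vfix vdec.
  rewrite subn0 big_geq //=; suff -> : v = 1%g by rewrite eqxx.
  by apply/permP => i; rewrite perm1 vfix // subn0.
rewrite big_ltn; last by lia.
have -> : (n - m.+1).+1 = (n - m)%N by lia.
set K := \prod_(n - m <= i < n) _; rewrite /=.
have ltr : (n - m.+1 < n)%N by lia.
set r := (n - m.+1)%N in ltr vfix vdec *.
have rE : r = (n - m.+1)%N by [].
have -> : (n - (n - m) = m)%N by lia.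
clearbody r.
pose ro := Ordinal ltr; have ero : ro = r :> nat by [].
have vro : v ro = (r + m)%N :> nat.
  have ltn1 : (n.-1 < n)%N by lia.
  pose q := v^-1%g (Ordinal ltn1).
  have vq : v q = n.-1 :> nat by rewrite permKV.
  have [ltq|leq] := ltnP q r; first by have := vfix q ltq; move/(congr1 val) => /=; lia.
  have [eqr|ltrq] := leqP q r.
    by have -> : ro = q; [apply: val_inj => /=; lia | lia].
  by have := vdec ro q; have := ltn_ord (v ro); rewrite /=; lia.
have {vdec} vdec : forall i j : 'I_n, (r < i < j)%N -> (v j < v i)%N.
  by move=> i j ij; apply: vdec; lia.
(* Along the row each crossing lowers the value at position [r] by one and keeps the later positions
   decreasing. *)
suff main c (u : 'S_n) : (c <= m)%N -> (forall i : 'I_n, (i < r)%N -> u i = i) ->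
    (forall i j : 'I_n, (r < i < j)%N -> (u j < u i)%N) -> u ro = (r + c)%N :> nat ->
    pipe_row Y (X r) r c (pipe_poly Y X m) u = \prod_(0 <= j < c) (1 - X r * Y j) * K.
  exact: main.
elim: c u {v vfix vdec vro} => [|c IHc] v lec vfix vdec vro.
  rewrite big_geq // mul1r /= IH //; first by lia.
    move=> i lti; have [ltir|lei] := ltnP i r; first exact: vfix.
    have -> : i = ro by apply: val_inj => /=; lia.
    by apply: val_inj; rewrite /= vro; lia.
  by move=> i j ij; apply: vdec; lia.
rewrite big_nat_recr //= [RHS]mulrAC [RHS]mulrC /dop.
rewrite (@pipe_row_poly_eq0 m c v ro) //; last by rewrite vro /=; lia.
rewrite mulr0 add0r; congr (_ * _).
have ltk : (r + c < n)%N by lia.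
pose b := v^-1%g (Ordinal ltk); have vb : v b = (r + c)%N :> nat by rewrite permKV.
have va : v ro = (r + c).+1 :> nat by rewrite vro; lia.
have ltb : (ro < b)%N.
  case: ltngtP => // [ltbr|eb].
    by have := vfix b ltbr; move/(congr1 val); rewrite /= vb; lia.
  have e : b = ro by apply: val_inj.
  by move: vb; rewrite e va; lia.
have lv x := ldem_val x va vb.
apply: IHc; first by lia.
- move=> i ltir; apply: val_inj; rewrite /= lv.
  rewrite /= ltb -!val_eqE /= vfix // !ifN_eq //; lia.
- move=> i j ij; rewrite !lv /= ltb -!val_eqE /=.
  have vij := vdec i j ij.
  have nvi : v i != v ro by rewrite (inj_eq perm_inj) -val_eqE /=; lia.
  have nvj : v j != v ro by rewrite (inj_eq perm_inj) -val_eqE /=; lia.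
  have ei : (i == b :> nat) = (v i == r + c :> nat)%N.
    by rewrite -vb !val_eqE (inj_eq perm_inj).
  have ej : (j == b :> nat) = (v j == r + c :> nat)%N.
    by rewrite -vb !val_eqE (inj_eq perm_inj).
  rewrite ei ej; move: nvi nvj; rewrite -!val_eqE /= va.
  by repeat case: eqP => ?; lia.
by rewrite lv ltb /= eqxx.
Qed.

End Vanishing.

(** * From pipe dreams to double Grothendieck polynomials *)

Lemma rmorph_pipe_poly n (R S : comNzRingType) (f : {rmorphism R -> S}) (X Y : nat -> R)
    m (w : 'S_n) :
  f (pipe_poly Y X m w) = pipe_poly (f \o Y) (f \o X) m w.
Proof.
have rowE x r c Phi (v : 'S_n) : f (pipe_row Y x r c Phi v) =
    pipe_row (f \o Y) (f x) r c (f \o Phi) v.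
  elim: c v => //= c IH v; rewrite /dop -!IH.
  by rewrite rmorphD !rmorphM rmorphB rmorph1 rmorphM.
elim: m w => [|m IH] w /=; first by rewrite rmorph_nat.
by rewrite rowE; apply: eq_pipe_row.
Qed.

Lemma eq_pipe_polyY n (R : comNzRingType) (X Y Y' : nat -> R) m (w : 'S_n) :
  Y =1 Y' -> pipe_poly Y X m w = pipe_poly Y' X m w.
Proof.
move=> eY; have rowE x r c Phi (v : 'S_n) : pipe_row Y x r c Phi v = pipe_row Y' x r c Phi v.
  by elim: c v => //= c IH v; rewrite /dop !IH eY.
by elim: m w => //= m IH w; rewrite (eq_pipe_row _ _ _ _ IH) rowE.
Qed.

Section PipeGrothendieck.
Variable n : nat.

Definition xseq t : dpoly n := 1 - xvar n t.+1.
Definition yseq t : dpoly n := 1 - yvar n t.+1.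

Lemma xyseq i j : 1 - xseq i * yseq j = xvar n i.+1 ⊕ yvar n j.+1.
Proof. by rewrite /xseq /yseq /oplus; ring. Qed.

Lemma pipe_poly_longest : pipe_poly yseq xseq n (longest n) = groth_longest n.
Proof.
rewrite pipe_poly_longest_rec //; first last.
- by move=> i j ij; have := ltn_ord j; rewrite !permE /=; lia.
- by move=> i; rewrite subnn.
rewrite subnn /groth_longest big_mkord; apply: eq_bigr => i _.
rewrite -(big_mkord (fun j => i.+1 + j.+1 <= n)%N (fun j => xvar n i.+1 ⊕ yvar n j.+1)).
rewrite (big_nat_widen _ _ n) /=; last by lia.
apply: eq_big => [j|j _]; [lia|exact: xyseq].
Qed.

Lemma srefl_compl (i : 'I_n) (p : dpoly n) : srefl i (1 - p) = 1 - srefl i p.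
Proof. by rewrite /srefl rmorphB rmorph1. Qed.

Lemma srefl_xvar (i : 'I_n) t : (i.+1 < n)%N ->
  srefl i (xseq t) = swap_seq i xseq t.
Proof.
move=> lti; have vi := nextoK lti.
rewrite /xseq srefl_compl /xvar /swap_seq.
have xo (j : 'I_n) : oapp (fun k : 'I_n => 'X_k) 0 (insub (j : nat)) = 'X_j :> dpoly n.
  by rewrite valK.
case: insubP => [j _ <-|nt] /=.
  rewrite sreflX /simple_refl; case: tpermP => [->|->|/eqP ji /eqP jn].
  - by rewrite eqxx -[i.+1]vi xo.
  - by rewrite vi eqxx ifN_eq ?xo //; lia.
  rewrite ifN_eq ?ifN_eq ?xo // -?vi ?val_eqE //.
by rewrite /srefl rmorph0 !ifN_eq //; have := ltn_ord i; lia.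
Qed.

Lemma srefl_yvar (i : 'I_n) t : srefl i (yseq t) = yseq t.
Proof.
rewrite /yseq srefl_compl /yvar; case: insub => [j|] /=; last by rewrite /srefl rmorph0.
by rewrite /srefl /msym mmapC.
Qed.

Lemma srefl_pipe_poly (i : 'I_n) (X : nat -> dpoly n) m (w : 'S_n) :
  srefl i (pipe_poly yseq X m w) = pipe_poly yseq (srefl i \o X) m w.
Proof.
pose f : {rmorphism dpoly n -> dpoly n} := msym (simple_refl i).
rewrite -[LHS]/(f _) rmorph_pipe_poly; apply: eq_pipe_polyY => c.
exact: srefl_yvar.
Qed.

(** Descending induction on the length: [pipe_poly_swap] at [swap_pos w i] is the defining recursion
    multiplied by the cancellable factor [x_i - x_(i+1)]. *)
Lemma groth_pipe_poly (w : 'S_n) : groth w = pipe_poly yseq xseq n w.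
Proof.
have [d] := ubnP (n ^ 2 - perm_length w)%N; elim: d w => // d IH w ltd.
have [->|nl] := eqVneq w (longest n); first by rewrite groth_longestE pipe_poly_longest.
have [i ai] := longest_ascent nl; rewrite (groth_ascent ai).
have := ai; rewrite ascentE => /andP[lti ltw].
rewrite IH; last first.
  move/eqP: ai => ai; have := max_card (mem (inversions (swap_pos w i))).
  by rewrite card_prod card_ord -/(perm_length _) ai; lia.
have vi := nextoK lti.
have nX : 'X_i - 'X_(nexto i) != 0 :> dpoly n by apply: mpolyXB_neq0; lia.
apply: (mulIf nX); rewrite isobaricE //.
have := @pipe_poly_swap n _ yseq xseq n i (swap_pos w i) (leqnn n).
rewrite subnn rdem_ord !swap_posE /simple_refl tpermL tpermR ltw swap_posK.
move/(_ isT lti).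
rewrite -(@eq_pipe_poly _ _ _ (srefl i \o xseq) (swap_seq i xseq)) //;
  last by move=> t _; apply: srefl_xvar.
rewrite -srefl_pipe_poly.
have xE (j : 'I_n) : xseq j = 1 - 'X_j by rewrite /xseq /xvar valK.
rewrite -[in X in X -> _]vi !xE => e.
by rewrite -[X in _ - X]e; ring.
Qed.

End PipeGrothendieck.

(** * Tableaux indexed by inversions *)

Section InversionTableaux.
Variable n : nat.
Implicit Types (v w : 'S_n) (g h i a b : 'I_n) (B C : 'I_n * 'I_n) (t : 'I_n.+1) (r c m k : nat).
Implicit Types (T : {ffun 'I_n * 'I_n -> 'I_n.+1}) (Z : {set ('I_n * 'I_n) * 'I_n.+1}).

Lemma mem_inversions v i h : ((i, h) \in inversions v) = (i < h)%N && (v h < v i)%N.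
Proof. by rewrite inE. Qed.

(** One less than [m_ij] for the square in row [B.1] and column [v B.2], which is not counted
    itself. *)
Definition inv_rank v B : nat := #|[set h : 'I_n | (B.1 < h)%N && (v h < v B.2)%N]|.

Lemma card_perm_lt v k : (k <= n)%N -> #|[set x : 'I_n | (v x < k)%N]| = k.
Proof.
move=> lek.
have -> : [set x | (v x < k)%N] = (fun j : 'I_k => v^-1%g (widen_ord lek j)) @: setT.
  apply/setP => x; rewrite inE; apply/idP/imsetP => [ltx|[j _ ->]].
    by exists (Ordinal ltx) => //; rewrite -[LHS](permK v); congr (_ _); apply: val_inj.
  by rewrite permKV /=.
rewrite card_imset ?cardsT ?card_ord // => j j' /perm_inj /(congr1 val) /= e.
exact: val_inj.
Qed.

(** Both sides count the positions that precede [B.1] or carry a value below [v B.2]. *)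
Lemma inv_rankE v B : B \in inversions v ->
  (inv_rank v B + B.1 = v B.2 + #|[set g : 'I_n | (g < B.1) && (v B.2 < v g)]|)%N.
Proof.
case: B => i h; rewrite mem_inversions /= => /andP[ltih ltv].
have e1 := card_perm_lt v (ltnW (ltn_ord (v h))).
have e2 : #|[set g : 'I_n | (g < i)%N]| = i.
  rewrite -[RHS](card_perm_lt 1%g (ltnW (ltn_ord i))).
  by apply: eq_card => x; rewrite !inE perm1.
set A := [set x | _] in e1; set L := [set g | _] in e2.
have c1 := cardsID L A; have c2 := cardsID A L; rewrite setIC in c2.
have -> : inv_rank v (i, h) = #|A :\: L|.
  apply: eq_card => x; rewrite !inE; case: (ltngtP i x) => //= e.
  have -> : x = i by apply: val_inj.
  by rewrite ltnNge (ltnW ltv).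
have -> : #|[set g : 'I_n | (g < i)%N && (v h < v g)%N]| = #|L :\: A|.
  apply: eq_card => x; rewrite !inE; case: (ltngtP (v h) (v x)) => //= e; rewrite ?andbF ?andbT //.
  by move/val_inj/perm_inj: e => <-; lia.
lia.
Qed.

(** The positions counted come after [B.1] and differ from [B.2]. Hence every entry within the flag
    belongs to a cell of the staircase. *)
Lemma inv_rank_lt v B : B \in inversions v -> (inv_rank v B + B.1 < n.-1)%N.
Proof.
case: B => i h; rewrite mem_inversions /= => /andP[ltih ltv].
have e2 : #|[set g : 'I_n | (g <= i)%N]| = i.+1.
  rewrite -[RHS](card_perm_lt 1%g (ltn_ord i)).
  by apply: eq_card => x; rewrite !inE perm1.
set L := [set g | _] in e2; have := cardsC L; rewrite card_ord e2 => cL.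
have := cardsD1 h (~: L); rewrite !inE -ltnNge ltih => cLh.
suff: (inv_rank v (i, h) <= #|~: L :\ h|)%N by lia.
apply/subset_leq_card/subsetP => x; rewrite !inE -ltnNge /= => /andP[-> ltx].
by rewrite andbT; apply: contraTneq ltx => ->; rewrite ltnn.
Qed.

(** An entry [t] belongs to row [t - 1] of the pipe dream: the rows above [r] are used up, and only
    the first [c] cells of row [r] are left. *)
Definition allowed r c v B t : bool :=
  (r < t <= B.1.+1)%N && ((t == r.+1 :> nat) ==> (inv_rank v B + B.1 < r + c)%N).

(** The tableaux of shape [D(v)] that are still available when the cells [(r, c - 1)], ...,
    [(r, 0)] and the rows below [r] remain, the square of [D(v)] in row [i] and column
    [v h] being encoded by the inversion [(i, h)]: this encoding survives the
    multiplications by [s_k] on the left. *)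
Definition is_tab r c v Z T : Prop :=
  [/\ forall B, B \in inversions v -> allowed r c v B (T B) && ((B, T B) \in Z),
      forall i h h', (i, h) \in inversions v -> (i, h') \in inversions v ->
        (v h < v h')%N -> (T (i, h') <= T (i, h))%N
    & forall i i' h, (i, h) \in inversions v -> (i', h) \in inversions v ->
        (i < i')%N -> (T (i, h) < T (i', h))%N].

Definition tab_event r c v Z : bool :=
  [exists T : {ffun 'I_n * 'I_n -> 'I_n.+1},
    [&& [forall B in inversions v, allowed r c v B (T B) && ((B, T B) \in Z)],
        [forall i, forall h, forall h', ((i, h) \in inversions v) ==>
          ((i, h') \in inversions v) ==> (v h < v h')%N ==> (T (i, h') <= T (i, h))%N]
      & [forall i, forall i', forall h, ((i, h) \in inversions v) ==>
          ((i', h) \in inversions v) ==> (i < i')%N ==> (T (i, h) < T (i', h))%N]]].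

Lemma tab_eventP r c v Z : reflect (exists T, is_tab r c v Z T) (tab_event r c v Z).
Proof.
apply: (iffP existsP) => -[T].
  case/and3P=> /forall_inP h1 /forallP h2 /forallP h3; exists T; split=> //.
    move=> i h h' Dh Dh' lt.
    by move/(_ i): h2 => /forallP/(_ h)/forallP/(_ h'); rewrite Dh Dh' lt.
  move=> i i' h Dh Dh' lt.
  by move/(_ i): h3 => /forallP/(_ i')/forallP/(_ h); rewrite Dh Dh' lt.
case=> h1 h2 h3; exists T; apply/and3P; split; first by apply/forall_inP.
  by apply/forallP => i; apply/forallP => h; apply/forallP => h'; do 3!apply/implyP => ?; apply: h2.
by apply/forallP => i; apply/forallP => h; apply/forallP => h'; do 3!apply/implyP => ?; apply: h3.
Qed.

(** The entry [r + 1] of the square [(i, h)] belongs to the cell [(r, c)] if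
    [inv_rank v (i, h) + i = r + c]. *)
Lemma critical_entry r c v Z T i h : is_tab r c.+1 v Z T -> (i, h) \in inversions v ->
  T (i, h) = r.+1 :> nat -> (inv_rank v (i, h) + i = r + c)%N ->
  [/\ v h = (r + c)%N :> nat, v i = (r + c).+1 :> nat
    & forall g, (g < i)%N -> (v g < r + c)%N].
Proof.
case=> h1 h2 h3 D Tr rk; have := D; rewrite mem_inversions => /andP[ltih ltv].
(* A square above [(i, h)] in its column would need an entry below [r + 1]. *)
have low g : (g < i)%N -> (v g < v h)%N.
  move=> ltg; rewrite ltnNge leq_eqVlt negb_or; apply/andP; split.
    by apply/eqP => /val_inj/perm_inj e; move: ltg; rewrite -e; lia.
  apply/negP => gth; have Dg : (g, h) \in inversions v by rewrite mem_inversions; lia.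
  have := h3 _ _ _ Dg D ltg; have /andP[/andP[/andP[+ _] _] _] := h1 _ Dg; lia.
have vh : v h = (r + c)%N :> nat.
  rewrite -rk; have := inv_rankE D; rewrite /= => ->.
  rewrite (_ : [set _ | _] = set0) ?cards0 ?addn0 //; apply/setP => g; rewrite !inE.
  by apply/negP => /andP[/low]; lia.
split=> //; last by move=> g /low; rewrite vh.
apply/eqP; rewrite eqn_leq; apply/andP; split; last by lia.
rewrite leqNgt; apply/negP => gtk.
have ltn_k : ((r + c).+1 < n)%N by have := ltn_ord (v i); lia.
(* The value [r + c + 1] would give a square to the right of [(i, h)]; its entry is forced to be
   [r + 1], whose cell is not among the remaining ones. *)
pose q := v^-1%g (Ordinal ltn_k); have vq : v q = (r + c).+1 :> nat by rewrite permKV.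
have ltiq : (i < q)%N.
  case: ltngtP => // [/low|/val_inj e]; first by lia.
  by move: gtk; rewrite e vq; lia.
have Dq : (i, q) \in inversions v by rewrite mem_inversions; lia.
have /andP[/andP[/andP[lo hi] al] _] := h1 _ Dq.
have le : (T (i, q) <= T (i, h))%N by apply: h2 => //; rewrite vh vq.
have eq : T (i, q) = r.+1 :> nat by apply/eqP; rewrite eqn_leq -{1}Tr le.
move: al; rewrite eq eqxx /=; have := inv_rankE Dq; rewrite /= vq; lia.
Qed.

Lemma tab_event_succ r c v Z :
  (forall T, is_tab r c.+1 v Z T -> forall i h, (i, h) \in inversions v ->
     T (i, h) = r.+1 :> nat -> (inv_rank v (i, h) + i)%N <> (r + c)%N) ->
  tab_event r c.+1 v Z = tab_event r c v Z.
Proof.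
move=> nocrit; apply/tab_eventP/tab_eventP => -[T tabT]; exists T; case: (tabT) => h1 h2 h3.
  split=> // -[i h] D; have /andP[/andP[bd al] ->] := h1 _ D; rewrite andbT /allowed bd /=.
  by apply/implyP => /eqP Tr; have := nocrit T tabT i h D Tr; move: al; rewrite Tr eqxx /=; lia.
split=> // -[i h] D; have /andP[/andP[bd al] ->] := h1 _ D; rewrite andbT /allowed bd /=.
by apply/implyP => Tr; move: al; rewrite Tr /=; lia.
Qed.

End InversionTableaux.

(** * Crossings that remove a single square *)

Section GoodCrossing.
Variables (n r c : nat) (v : 'S_n) (a b : 'I_n).
Hypotheses (va : v a = (r + c).+1 :> nat) (vb : v b = (r + c)%N :> nat).
Hypotheses (ltab : (a < b)%N) (low : forall g : 'I_n, (g < a)%N -> (v g < r + c)%N).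
Hypothesis fix_lt : forall i : 'I_n, (i < r)%N -> v i = i.
Local Notation s := (ldem (r + c) v).
Implicit Types (i h g : 'I_n) (B C : 'I_n * 'I_n).
Implicit Types (T : {ffun 'I_n * 'I_n -> 'I_n.+1}) (Z : {set ('I_n * 'I_n) * 'I_n.+1}).

Lemma good_val x : s x = (if v x == (r + c).+1 :> nat then (r + c)%N
  else if v x == r + c :> nat then (r + c).+1 else v x)%N :> nat.
Proof.
rewrite (ldem_val _ va vb) ltab -va -vb !val_eqE !(inj_eq perm_inj).
by rewrite va vb.
Qed.

Let eqa x : v x = (r + c).+1 :> nat -> x = a.
Proof. by rewrite -va => /val_inj/perm_inj. Qed.

Let eqb x : v x = (r + c)%N :> nat -> x = b.
Proof. by rewrite -vb => /val_inj/perm_inj. Qed.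

Let eqaN x : v x = (r + c).+1 :> nat -> x = a :> nat.
Proof. by move/eqa->. Qed.

Let eqbN x : v x = (r + c)%N :> nat -> x = b :> nat.
Proof. by move/eqb->. Qed.

Lemma good_inversions i h :
  ((i, h) \in inversions s) = ((i, h) \in inversions v) && ((i, h) != (a, b)).
Proof.
rewrite !mem_inversions !good_val.
have -> : ((i, h) == (a, b)) = (v i == (r + c).+1 :> nat) && (v h == r + c :> nat)%N.
  by rewrite xpair_eqE -va -vb !val_eqE !(inj_eq perm_inj).
have := eqaN (x := i); have := eqaN (x := h); have := eqbN (x := i); have := eqbN (x := h).
by repeat case: eqP => ?; lia.
Qed.

(** Only the positions [a] and [b] change their order; by [low] no position before [a] forms an
    inversion with either of them. *)
Lemma good_order i h h' : (i, h) \in inversions s -> (i < h')%N ->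
  ((s h < s h') = (v h < v h'))%N /\ ((s h' < s h) = (v h' < v h))%N.
Proof.
rewrite good_inversions xpair_eqE mem_inversions => /andP[/andP[ltih ltv] nab] ltih'.
have := eqaN (x := h'); have := eqaN (x := h); have := eqbN (x := h'); have := eqbN (x := h).
have lowi := low (g := i); rewrite !good_val.
have nb : v h = (r + c)%N :> nat -> i <> a.
  by move/eqb => eh ei; rewrite eh ei !eqxx in nab.
have na : i = a :> nat -> i = a by apply: val_inj.
by repeat case: eqP => ?; lia.
Qed.

Lemma good_rank B : B \in inversions s -> inv_rank s B = inv_rank v B.
Proof.
case: B => i h D; rewrite /inv_rank; apply: eq_card => x; rewrite !inE /=.
by case: ltnP => //= ltix; have [_ ->] := good_order D ltix.
Qed.

Lemma good_box : (a, b) \in inversions v.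
Proof. by rewrite mem_inversions va vb ltab /=. Qed.

Lemma good_box_rank : (inv_rank v (a, b) + a = r + c)%N.
Proof.
have := inv_rankE good_box; rewrite /= vb => ->.
rewrite (_ : [set _ | _] = set0) ?cards0 ?addn0 //; apply/setP => g; rewrite !inE.
by apply/negP => /andP[/low]; lia.
Qed.

Lemma good_row : (r <= a)%N.
Proof.
by rewrite leqNgt; apply/negP => lta; have /(congr1 val) := fix_lt lta; rewrite /= va; lia.
Qed.

Let t0 : 'I_n.+1 := inord r.+1.
Let t0E : t0 = r.+1 :> nat.
Proof. by rewrite inordK // ltnS; have := good_row; have := ltn_ord a; lia. Qed.

(** The square [(a, b)] is topmost in its column and rightmost in its row, so a tableau of the
    smaller diagram extends by the least entry [r + 1]. Conversely, by [critical_entry] no other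
    square uses the cell [(r, c)]. *)
Lemma good_event_with Z :
  tab_event r c.+1 v (((a, b), inord r.+1) |: Z) = tab_event r c s Z.
Proof.
rewrite -/t0; apply/tab_eventP/tab_eventP => -[T tabT]; case: (tabT) => h1 h2 h3.
  exists T; split.
  - move=> [i h] Ds; have := Ds; rewrite good_inversions => /andP[D nab].
    have /andP[/andP[bd al]] := h1 _ D; rewrite !inE xpair_eqE (negbTE nab) /= => ->.
    rewrite andbT /allowed bd (good_rank Ds) /=; apply/implyP => /eqP Tr.
    have := al; rewrite Tr eqxx /= => lt.
    suff : (inv_rank v (i, h) + i)%N <> (r + c)%N by lia.
    move=> rk; have [vh vi _] := critical_entry tabT D Tr rk.
    by case/eqP: nab; rewrite (eqa vi) (eqb vh).
  - move=> i h h' D D'.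
    have ltih' : (i < h')%N by move: D'; rewrite mem_inversions => /andP[].
    have [-> _] := good_order D ltih'.
    by move: D D'; rewrite !good_inversions => /andP[D _] /andP[D' _]; apply: h2.
  move=> i i' h; rewrite !good_inversions => /andP[D _] /andP[D' _]; exact: h3.
have Dsv i h : (i, h) != (a, b) -> (i, h) \in inversions v -> (i, h) \in inversions s.
  by move=> ne D; rewrite good_inversions D ne.
exists [ffun C => if C == (a, b) then t0 else T C]; split.
- move=> [i h] D; rewrite !ffunE; case: eqP => [[-> ->]|/eqP ne].
    rewrite !inE eqxx /= andbT /allowed t0E eqxx /= good_box_rank.
    by have := good_row; lia.
  have Ds := Dsv _ _ ne D; have /andP[/andP[bd al] TZ] := h1 _ Ds.
  rewrite !inE TZ orbT andbT /allowed bd /= -(good_rank Ds).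
  by apply/implyP => Tr; move: al; rewrite Tr /=; lia.
- move=> i h h' D D' lt; rewrite !ffunE.
  case: eqP => [[ei eh]|/eqP ne']; case: eqP => [[ei' eh']|/eqP ne] //.
  + have /andP[/andP[/andP[lo _] _] _] := h1 _ (Dsv _ _ ne D).
    by rewrite t0E.
  + move: D' lt; rewrite mem_inversions ei' eh' va vb; have := @eqaN h'; lia.
  have Ds := Dsv _ _ ne D; have Ds' := Dsv _ _ ne' D'.
  have ltih' : (i < h')%N by move: D'; rewrite mem_inversions => /andP[].
  by apply: h2 => //; have [-> _] := good_order Ds ltih'.
move=> i i' h D D' lt; rewrite !ffunE.
case: eqP => [[ei eh]|/eqP ne]; case: eqP => [[ei' eh']|/eqP ne'].
+ by move: lt; rewrite ei ei' ltnn.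
(* By [inv_rankE], an entry [r + 1] below [(a, b)] would belong to a column from [c] on, which is
   used up. *)
+ have Ds' := Dsv _ _ ne' D'; have /andP[/andP[/andP[lo _] al] _] := h1 _ Ds'.
  rewrite t0E ltn_neqAle lo andbT; apply/eqP => eT; move: al.
  rewrite -eT eqxx /= good_rank // (inv_rankE D') /= eh vb.
  by rewrite ltnNge leq_addr.
+ move: D; rewrite mem_inversions eh' vb => /andP[_].
  by have := low (g := i); move: lt; rewrite ei'; lia.
by apply: h3 => //; apply: Dsv.
Qed.

Lemma good_event_without Z :
  tab_event r c.+1 v (Z :\ ((a, b), inord r.+1)) = tab_event r c v Z.
Proof.
rewrite -/t0; apply/tab_eventP/tab_eventP => -[T tabT]; exists T; case: (tabT) => h1 h2 h3.
  split=> // -[i h] D; have /andP[/andP[bd al]] := h1 _ D.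
  rewrite !inE => /andP[nu ->]; rewrite andbT /allowed bd /=; apply/implyP => /eqP Tr.
  have := al; rewrite Tr eqxx /= => lt.
  suff : (inv_rank v (i, h) + i)%N <> (r + c)%N by lia.
  move=> rk; have [vh vi _] := critical_entry tabT D Tr rk.
  case/eqP: nu; rewrite (eqa vi) (eqb vh) -(eqa vi) -(eqb vh); congr (_, _).
  by apply: val_inj; rewrite /= t0E.
split=> // -[i h] D; have /andP[/andP[bd al] TZ] := h1 _ D.
rewrite !inE TZ andbT /allowed bd /=; apply/andP; split.
  by apply/implyP => Tr; move: al; rewrite Tr /=; lia.
by apply/eqP => -[ei eh eT]; move: al; rewrite eT t0E eqxx ei eh /= good_box_rank ltnn.
Qed.

End GoodCrossing.

(** * Equality of the two probabilities *)

Section PipeTableaux.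
Variables (n : nat) (R : comNzRingType) (X Y : nat -> R).
Variable p : ('I_n * 'I_n) * 'I_n.+1 -> R.
Implicit Types (u v w : 'S_n) (g h i a b : 'I_n) (r c m : nat).

Definition avoids_from r v : Prop := forall g h a b, (r <= g)%N -> (g < h)%N -> (h < a)%N ->
  (a < b)%N -> (v g < v b)%N -> (v b < v a)%N -> (v a < v h)%N -> False.

(** Selecting [t] in [B] is as likely as a crossing in the cell to which this entry belongs. *)
Definition cell_weights r v : Prop := forall B (t : 'I_n.+1), B \in inversions v ->
  (r < t <= B.1.+1)%N -> p (B, t) = 1 - X t.-1 * Y (inv_rank v B + B.1.+1 - t)%N.

(** An exhausted row [r] excludes the entry [r + 1], while by [inv_rank_lt] a full row [r + 1]
    excludes nothing. *)
Lemma row_end_event r v Z : (r < n)%N -> (forall i, (i <= r)%N -> v i = i) ->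
  tab_event r 0 v Z = tab_event r.+1 (n - r.+2) v Z.
Proof.
move=> ltr fx; apply/tab_eventP/tab_eventP => -[T [h1 h2 h3]]; exists T; split=> // -[i h] D;
  have /andP[/andP[/andP[lo hi] al] ->] := h1 _ D; rewrite andbT /allowed /= in hi al *.
  have lt : (r.+1 < T (i, h))%N.
    by rewrite ltn_neqAle lo andbT; apply/eqP => e; move: al; rewrite -e eqxx /=; lia.
  rewrite lt hi /=; apply/implyP => _; have := inv_rank_lt D => /=; lia.
rewrite hi (ltnW lo) /=; apply/implyP; lia.
Qed.

(** The value [r] stands after position [r] and gives a square in row [r]; its flag forces the entry
    [r + 1], for which no cell is left. *)
Lemma displaced_event r v (ro : 'I_n) Z : ro = r :> nat ->
  (forall i, (i < r)%N -> v i = i) -> v ro != ro -> tab_event r 0 v Z = false.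
Proof.
move=> roE fx nro; apply/tab_eventP => -[T [h1 _ _]].
pose x := v^-1%g ro; have vx : v x = ro by rewrite permKV.
have ltx : (r < x)%N.
  case: ltngtP => // [ltx|ex].
    by have := fx x ltx; rewrite vx => e; move: ltx; rewrite -e roE ltnn.
  have e : x = ro by apply: val_inj; rewrite /= roE.
  by case/eqP: nro; rewrite -{1}e.
have vr : (r < v ro)%N.
  case: ltngtP => // [lt|e]; last by case/eqP: nro; apply: val_inj; rewrite /= roE.
  by have /perm_inj e := fx _ lt; move: lt; rewrite e roE ltnn.
have D : (ro, x) \in inversions v by rewrite mem_inversions vx roE ltx vr.
have /andP[/andP[/= /andP[lo hi] al] _] := h1 _ D.
have e : T (ro, x) = r.+1 :> nat by rewrite roE in hi; apply/eqP; rewrite eqn_leq hi lo.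
by move: al; rewrite e eqxx /= roE; lia.
Qed.

(** Patterns starting at [r] are excluded only if their 2 is below [r + c]: multiplication by
    [s_(r+c)] can create a 1432 with 1 and 2 at the values [r + c] and [r + c + 1], and this bound
    makes the hypothesis inductive. *)
Lemma pipe_row_prob m r c v (ro : 'I_n) : ro = r :> nat -> (n = r + m.+1)%N -> (c <= m)%N ->
  (forall u, (forall i, (i < r.+1)%N -> u i = i) -> avoids_from r.+1 u ->
     cell_weights r.+1 u ->
     pipe_poly Y X m u = prob p (tab_event r.+1 m.-1 u)) ->
  (forall i, (i < r)%N -> v i = i) ->
  avoids_from r.+1 v ->
  (forall h a b, (r < h)%N -> (h < a)%N -> (a < b)%N ->
     (v ro < v b)%N -> (v b < v a)%N -> (v a < v h)%N -> (v b < r + c)%N -> False) ->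
  cell_weights r v ->
  pipe_row Y (X r) r c (pipe_poly Y X m) v = prob p (tab_event r c v).
Proof.
move=> roE nE lec IHm; have ltrn : (r < n)%N by lia.
elim: c v lec => [|c IHc] v lec fx av av0 cw.
  have [vro|nro] := eqVneq (v ro) ro; last first.
    rewrite (eq_prob _ (fun Z => displaced_event Z roE fx nro)) prob_false /=.
    apply: (@pipe_poly_displaced _ _ _ _ _ _ (v^-1%g ro)); first by lia.
      by rewrite permKV roE; lia.
    by rewrite permKV eq_sym (canF_eq (permKV v)) eq_sym.
  have fx1 i : (i < r.+1)%N -> v i = i.
    rewrite ltnS leq_eqVlt => /orP[/eqP ei|]; last exact: fx.
    by have -> : i = ro; [apply: val_inj; rewrite /= roE|].
  rewrite /= IHm //; last by move=> B t D lt; apply: cw => //; lia.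
  apply: eq_prob => Z; rewrite [RHS]row_end_event //.
  by congr tab_event; lia.
have ltk : ((r + c).+1 < n)%N by lia.
pose a := v^-1%g (Ordinal ltk); have va : v a = (r + c).+1 :> nat by rewrite permKV.
pose b := v^-1%g (Ordinal (ltnW ltk)); have vb : v b = (r + c)%N :> nat by rewrite permKV.
clearbody a b; have lv x := ldem_val x va vb.
have IHv : pipe_row Y (X r) r c (pipe_poly Y X m) v = prob p (tab_event r c v).
  apply: IHc => // [|h' a' b' lt1 lt2 lt3 lt4 lt5 lt6 lt7]; first by lia.
  by apply: (av0 h' a' b') => //; lia.
(* If [r + c] stands before [r + c + 1], left multiplication is trivial, and by [critical_entry] no
   tableau uses the cell. *)
have [lta|geb] := ltnP a b; last first.
  have sv : ldem (r + c) v = v.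
    by apply/permP => x; apply: val_inj; rewrite /= lv ltnNge geb.
  rewrite /= /dop sv -mulrDl addrC subrK mul1r IHv; apply: eq_prob => Z.
  rewrite [RHS]tab_event_succ // => T tabT i h D Tr rk.
  have [vh vi _] := critical_entry tabT D Tr rk.
  move: D; rewrite mem_inversions; rewrite -va in vi; rewrite -vb in vh.
  by move/val_inj/perm_inj: vi => ->; move/val_inj/perm_inj: vh => ->; rewrite ltnNge geb.
(* Either the crossing removes the square [(a, b)], or a value above [r + c + 1] stands before [a]
   and both probabilities vanish. *)
have [low|/forall_inPn[h lth nlow]] := boolP [forall (g : 'I_n | (g < a)%N), (v g < r + c)%N].
  have {}low g : (g < a)%N -> (v g < r + c)%N by move/forall_inP: low => /(_ g).
  have lera := good_row va vb lta fx; have D := good_box va vb lta.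
  have rk := good_box_rank va vb lta low; have sE := good_val va vb lta.
  have invS (x y : 'I_n) : (x < y)%N -> (ldem (r + c) v y < ldem (r + c) v x)%N -> (v y < v x)%N.
    move=> ltxy lts.
    have : (x, y) \in inversions (ldem (r + c) v) by rewrite mem_inversions ltxy.
    by rewrite (good_inversions va vb lta) mem_inversions => /andP[/andP[_ ->]].
  have ninvS (x y : 'I_n) : (x < y)%N -> (ldem (r + c) v x < ldem (r + c) v y)%N ->
      (x, y) != (a, b) -> (v x < v y)%N.
    move=> ltxy lts ne; rewrite ltnNge leq_eqVlt negb_or; apply/andP; split.
      by apply/eqP => /val_inj/perm_inj e; move: ltxy; rewrite e ltnn.
    apply/negP => ltv.
    have : (x, y) \in inversions (ldem (r + c) v).
      by rewrite (good_inversions va vb lta) mem_inversions ltxy ltv.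
    by rewrite mem_inversions => /andP[_]; lia.
  have t0E : (inord r.+1 : 'I_n.+1) = r.+1 :> nat by rewrite inordK //; lia.
  rewrite (prob_condition _ _ ((a, b), inord r.+1)).
  rewrite (eq_prob _ (good_event_with va vb lta low fx)).
  rewrite (eq_prob _ (good_event_without va vb lta low fx)) -IHv.
  rewrite cw // ?t0E /=; last by lia.
  rewrite addnS subSS rk addKn.
  rewrite -IHc /dop; first by ring.
  - by lia.
  - by move=> i lti; rewrite ldem_val_out fx //; lia.
  (* A new 1432 has its 1 at [a] and its 2 at [b]; replacing [a] by position [r] gives one in
     [v]. *)
  - move=> g h a' b' ltrg lt1 lt2 lt3 lt4 lt5 lt6.
    have {}lt5 := invS _ _ lt3 lt5; have {}lt6 := invS _ _ lt2 lt6.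
    have [[eg eb]|ne] := eqVneq (g, b') (a, b); last first.
      by apply: (av g h a' b') => //; apply: ninvS => //; lia.
    rewrite eg eb in lt1 lt2 lt3 lt5 ltrg *.
    apply: (av0 h a' b) => //; [lia | rewrite vb; apply: low; lia | lia].
  (* The bound excludes [b' = b], whose new value is [r + c + 1]. *)
  - move=> h a' b' lt1 lt2 lt3 lt4 lt5 lt6 lt7.
    have {}lt5 := invS _ _ lt3 lt5; have {}lt6 := invS _ _ lt2 lt6.
    have ltb : (v b' < r + c.+1)%N by move: lt7; rewrite sE; repeat case: eqP => ?; lia.
    apply: (av0 h a' b') => //; apply: ninvS => //; first by lia.
    apply/eqP => -[_ eb]; move: lt7; rewrite eb sE vb eqxx; case: eqP => _; lia.
  move=> B t DB lt; have := DB; rewrite (surjective_pairing B) (good_inversions va vb lta).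
  rewrite -surjective_pairing => /andP[DB' _].
  by rewrite cw // -(good_rank va vb lta low DB).
have {}lth : (h < a)%N by [].
move: nlow; rewrite -leqNgt leq_eqVlt => /orP[/eqP eh|gth].
  have e : h = b by apply: (@perm_inj _ v); apply: val_inj; rewrite /= vb.
  by move: lth; rewrite e; lia.
have neh : v h <> (r + c).+1 :> nat.
  by rewrite -va => /val_inj/perm_inj e; move: lth; rewrite e ltnn.
(* Otherwise [r], [h], [a], [b] would form a forbidden 1432. *)
have nlt : ((r + c).+1 < v ro)%N.
  have [lthr|lerh] := ltnP h r; first by have := fx h lthr => /(congr1 val) /=; lia.
  have [ehr|nhr] := eqVneq h ro; first by rewrite -ehr; lia.
  have ltrh : (r < h)%N.
    by rewrite ltn_neqAle lerh andbT; apply: contraNneq nhr => e; apply/eqP/val_inj; rewrite /= roE.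
  have nra : v ro <> (r + c).+1 :> nat.
    by rewrite -va => /val_inj/perm_inj e; move: lth ltrh; rewrite -e -roE; lia.
  have nrb : v ro <> (r + c)%N :> nat.
    by rewrite -vb => /val_inj/perm_inj e; move: lta lth ltrh; rewrite -e -roE; lia.
  rewrite ltnNge; apply/negP => le.
  by apply: (av0 h a b) => //; lia.
rewrite /= /dop.
have Z0 (u : 'S_n) : (u ro = v ro) -> pipe_row Y (X r) r c (pipe_poly Y X m) u = 0.
  by move=> e; rewrite -roE; apply: pipe_row_poly_eq0; rewrite ?e; lia.
rewrite !Z0 ?mulr0 ?addr0 //; last by rewrite ldem_val_out //; lia.
(* The vanishing passes to the tableau event through [IHv]. *)
rewrite -(Z0 v erefl) IHv; apply: eq_prob => Z.
rewrite [RHS]tab_event_succ // => T tabT i h' D Tr rk.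
have [_ vi low] := critical_entry tabT D Tr rk.
rewrite -va in vi; move/val_inj/perm_inj: vi => ei; rewrite ei in low.
by have := low h lth; lia.
Qed.

Lemma pipe_poly_prob m v : (m <= n)%N -> (forall i, (i < n - m)%N -> v i = i) ->
  avoids_from (n - m) v -> cell_weights (n - m) v ->
  pipe_poly Y X m v = prob p (tab_event (n - m) m.-1 v).
Proof.
elim: m v => [|m IH] v lem fx av cw.
  have -> : v = 1%g by apply/permP => i; rewrite perm1 fx // subn0.
  rewrite /= eqxx -(prob_true p); apply: eq_prob => Z; apply/esym/tab_eventP.
  have D (B : 'I_n * 'I_n) : (B \in inversions (1%g : 'S_n)) = false.
    by rewrite inE !perm1; lia.
  by exists [ffun=> ord0]; split=> [B|i h h'|i i' h]; rewrite D.
have r1E : (n - m = (n - m.+1).+1)%N by lia.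
have ltr : (n - m.+1 < n)%N by lia.
apply: (@pipe_row_prob _ _ _ _ (Ordinal ltr)) => //.
- by lia.
- by move=> u ufx uav ucw; rewrite -r1E; apply: IH => //; rewrite ?r1E //; lia.
- by move=> g h a b lt; apply: av; lia.
by move=> h a b lt1 lt2 lt3 lt4 lt5 lt6 _; apply: (av (Ordinal ltr) h a b).
Qed.

End PipeTableaux.

(** * Rothe tableaux *)

Section RotheTableaux.
Variables (n : nat) (w : 'S_n).
Local Notation box := ('I_n * 'I_n)%type.
Local Notation entry := 'I_n.+1.
Implicit Types (B C : box) (t : entry) (f g : {ffun box -> entry}) (S T : filling n).
Implicit Types (Z : {set box * entry}).
Local Notation flag0 := (@flag0 n).

Lemma mem_rothe (i h : 'I_n) : ((i, w h) \in rothe w) = ((i, h) \in inversions w).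
Proof.
rewrite mem_inversions inE /= andbC; congr (_ && _).
apply/existsP/idP => [[h' /andP[lt /eqP/perm_inj <-]] //|lt].
by exists h; rewrite lt eqxx.
Qed.

Lemma rothe_rank_inv (i h : 'I_n) : (i, h) \in inversions w ->
  rothe_rank w (i, w h) = (inv_rank w (i, h)).+1.
Proof.
rewrite mem_inversions => /andP[ltih ltw].
rewrite /rothe_rank /= -[LHS](card_imset _ (@perm_inj _ w^-1%g)).
rewrite (cardsD1 h) (_ : h \in _); last first.
  by apply/imsetP; exists (w h); rewrite ?permK // inE mem_rothe mem_inversions ltih ltw /=.
rewrite add1n; congr _.+1; apply: eq_card => x; rewrite !inE /=.
have -> : (x \in [set w^-1%g k | k in [set k | (i, k) \in rothe w & (k <= w h)%N]]) =
    (i < x)%N && (w x <= w h)%N.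
  apply/imsetP/andP => [[k + ->]|[lt le]].
    by rewrite inE -{1}(permKV w k) mem_rothe mem_inversions permKV => /andP[/andP[-> _] ->].
  exists (w x); rewrite ?permK // inE mem_rothe mem_inversions lt le andbT /=.
  exact: leq_ltn_trans ltw.
rewrite (leq_eqVlt (w x)) val_eqE (inj_eq perm_inj).
by case: eqP => [->|_] /=; rewrite ?ltnn ?andbF.
Qed.

Definition flagged_tab f : Prop :=
  [/\ forall B, B \in rothe w -> (0 < f B <= B.1.+1)%N,
      forall B C, B \in rothe w -> C \in rothe w -> B.1 = C.1 -> (B.2 < C.2)%N ->
        (f C <= f B)%N
    & forall B C, B \in rothe w -> C \in rothe w -> B.2 = C.2 -> (B.1 < C.1)%N ->
        (f B < f C)%N].

Definition single f : filling n := [ffun B => if B \in rothe w then [set f B] else set0].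

Definition the_entry T : {ffun box -> entry} := [ffun B => odflt ord0 [pick t in T B]].

Lemma flag0E (i : 'I_n) : flag0 i = i.+1 :> nat.
Proof. by rewrite /Defs.flag0 lift0. Qed.

Lemma single_SRT f : reflect (flagged_tab f) (single f \in SRT w flag0).
Proof.
rewrite inE; apply: (iffP andP) => [[/and4P[fil _ row col] flg]|[bd row col]].
  have sE B : B \in rothe w -> single f B = [set f B] by move=> DB; rewrite ffunE DB.
  split=> [B DB|B C DB DC e lt|B C DB DC e lt].
  - have /forall_inP/(_ B DB)/forall_inP/(_ (f B)) := flg; rewrite flag0E sE // set11 => -> //.
    have /forallP/(_ B) := fil; rewrite DB sE // => /andP[_]; rewrite inE.
    by rewrite andbT lt0n eq_sym -val_eqE.
  - have /forall_inP/(_ B DB)/forall_inP/(_ C DC) := row; rewrite e eqxx lt /= !sE //.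
    by move/forall_inP/(_ (f B))/(_ (set11 _))/forall_inP/(_ (f C) (set11 _)).
  have /forall_inP/(_ B DB)/forall_inP/(_ C DC) := col; rewrite e eqxx lt /= !sE //.
  by move/forall_inP/(_ (f B))/(_ (set11 _))/forall_inP/(_ (f C) (set11 _)).
split; last first.
  apply/forall_inP => B DB; apply/forall_inP => t; rewrite ffunE DB inE => /eqP->.
  by rewrite flag0E; have /andP[] := bd B DB.
apply/and4P; split.
- apply/forallP => B; rewrite ffunE; case DB: (B \in rothe w); last by [].
  apply/andP; split; first by apply/set0Pn; exists (f B); rewrite set11.
  by have /andP[+ _] := bd B DB; apply: contraTN => /set1P <-.
- by apply/forall_inP => B DB; rewrite ffunE DB cards1.
- apply/forall_inP => B DB; apply/forall_inP => C DC; apply/implyP => /andP[/eqP e lt].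
  rewrite !ffunE DB DC; apply/forall_inP => s /set1P->; apply/forall_inP => t /set1P->.
  exact: row.
apply/forall_inP => B DB; apply/forall_inP => C DC; apply/implyP => /andP[/eqP e lt].
rewrite !ffunE DB DC; apply/forall_inP => s /set1P->; apply/forall_inP => t /set1P->.
exact: col.
Qed.

Lemma SRT_single T : T \in SRT w flag0 -> T = single (the_entry T).
Proof.
rewrite inE => /andP[/and4P[/forallP fil /forall_inP c1 _ _] _].
apply/ffunP => B; rewrite ffunE; have := fil B; case: ifP => DB; last by move/eqP.
have /cards1P[t Tt] := c1 B DB; rewrite ffunE Tt => _.
by case: pickP => [x /set1P-> //|/(_ t)]; rewrite set11.
Qed.

Lemma SRT_flagged T : T \in SRT w flag0 -> flagged_tab (the_entry T).
Proof. by move=> ST; apply/single_SRT; rewrite -SRT_single. Qed.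

Definition vertices (F : box -> {set entry}) : {set box * entry} :=
  [set u | (u.1 \in rothe w) && (u.2 \in F u.1)].

Lemma vertices_single f Z : (vertices (single f) \subset Z) =
  [forall B in rothe w, (B, f B) \in Z].
Proof.
apply/subsetP/forall_inP => [sub B DB|sub [B t]].
  by apply: sub; rewrite inE /= DB ffunE DB set11.
by rewrite inE /= ffunE => /andP[DB]; rewrite DB => /set1P->; apply: sub.
Qed.

Lemma prod_vertices (R : comNzRingType) (F : box -> {set entry}) (q : box * entry -> R) :
  \prod_(u in vertices F) q u = \prod_(B in rothe w) \prod_(t in F B) q (B, t).
Proof.
rewrite pair_big_dep /=; apply: eq_big => [[B t]|[B t] _] //=.
by rewrite inE.
Qed.

Definition srt_event Z : bool := [exists T in SRT w flag0, vertices T \subset Z].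

Lemma srt_eventP Z :
  reflect (exists2 f, flagged_tab f & forall B, B \in rothe w -> (B, f B) \in Z) (srt_event Z).
Proof.
apply: (iffP exists_inP) => [[T ST]|[f vf sub]].
  rewrite {1}(SRT_single ST) vertices_single => /forall_inP sub.
  by exists (the_entry T); first exact: SRT_flagged.
exists (single f); first exact/single_SRT.
by rewrite vertices_single; apply/forall_inP.
Qed.

Definition to_inversion (u : box * entry) : box * entry := ((u.1.1, w^-1%g u.1.2), u.2).

Lemma to_inversion_bij : bijective to_inversion.
Proof.
exists (fun u => ((u.1.1, w u.1.2), u.2)) => -[[i j] t]; rewrite /to_inversion /=.
  by rewrite permKV.
by rewrite permK.
Qed.

Lemma tab_event_srt Z : tab_event 0 n.-1 w (to_inversion @: Z) = srt_event Z.
Proof.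
have memZ i h t : (((i, h), t) \in to_inversion @: Z) = (((i, w h), t) \in Z).
  rewrite -[RHS](mem_imset _ _ (bij_inj to_inversion_bij)).
  by rewrite /to_inversion /= permK.
have invR i j : ((i, w^-1%g j) \in inversions w) = ((i, j) \in rothe w).
  by rewrite -mem_rothe permKV.
apply/tab_eventP/srt_eventP => [[T [h1 h2 h3]]|[f [h1 h2 h3] sub]].
  exists [ffun B => T (B.1, w^-1%g B.2)]; first split.
  - move=> [i j]; rewrite ffunE -invR /= => D.
    by have /andP[/andP[-> _] _] := h1 _ D.
  - move=> [i j] [i' j'] /=; rewrite !ffunE -!invR /= => D D' e lt.
    by rewrite -e in D' *; apply: h2 => //; rewrite !permKV.
  - move=> [i j] [i' j'] /=; rewrite !ffunE -!invR /= => D D' e lt.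
    by rewrite -e in D' *; apply: h3.
  move=> [i j]; rewrite ffunE -invR /= => D.
  by have /andP[_] := h1 _ D; rewrite memZ permKV.
exists [ffun B => f (B.1, w B.2)]; split.
- move=> [i h] D; rewrite ffunE /= memZ sub ?mem_rothe // andbT /allowed.
  have /= -> := h1 (i, w h) _; last by rewrite mem_rothe.
  by apply/implyP => _; apply: inv_rank_lt.
- by move=> i h h' D D' lt; rewrite !ffunE; apply: h2; rewrite ?mem_rothe.
by move=> i i' h D D' lt; rewrite !ffunE; apply: h3; rewrite ?mem_rothe.
Qed.

Hypothesis hw : avoids1432 w.

Lemma groth_prob :
  groth w = prob (fun u : box * entry => entry_weight w u.1 u.2) srt_event.
Proof.
pose p (u : box * entry) := entry_weight w (u.1.1, w u.1.2) u.2.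
rewrite groth_pipe_poly (@pipe_poly_prob _ _ _ _ p) ?subnn //.
- rewrite (prob_reindex _ _ to_inversion_bij) (eq_prob _ tab_event_srt) /prob.
  apply: eq_bigr => Z _; apply: eq_bigr => -[[i j] t] _.
  by rewrite /p /= permKV.
- move=> g h a b _ lt1 lt2 lt3 lt4 lt5 lt6; move: hw; rewrite /avoids1432.
  case/negP; apply/existsP; exists g; apply/existsP; exists h; apply/existsP; exists a.
  by apply/existsP; exists b; rewrite lt1 lt2 lt3 lt4 lt5.
(* [rothe_rank] exceeds [inv_rank] by one, which matches the shift from [yseq] to the 1-based
   [yvar]. *)
move=> [i h] t D /= /andP[t0 ti]; rewrite /p /entry_weight /= rothe_rank_inv //.
rewrite xyseq prednK //; congr (_ ⊕ yvar _ _); lia.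
Qed.

Lemma coentry_weightE B t : coentry_weight w B t = 1 - entry_weight w B t.
Proof. by rewrite /coentry_weight /entry_weight /oplus; ring. Qed.

(** The common form of both formulas: the tableau event is partitioned into cylinders, one for each
    [T], whose selections contain [T] and avoid [F T]. *)
Lemma groth_cylinders (P : pred (filling n)) (F : filling n -> box -> {set entry}) :
  (forall Z, srt_event Z = [exists T, P T &&
      ((vertices T \subset Z) && [disjoint vertices (F T) & Z])]) ->
  (forall Z T T', P T -> P T' ->
     (vertices T \subset Z) && [disjoint vertices (F T) & Z] ->
     (vertices T' \subset Z) && [disjoint vertices (F T') & Z] -> T = T') ->
  (forall T B t, P T -> t \in T B -> t \notin F T B) ->
  groth w = \sum_(T | P T) \prod_(B in rothe w)
    ((\prod_(t in T B) entry_weight w B t) * (\prod_(t in F T B) coentry_weight w B t)).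
Proof.
move=> evE uniq dis; rewrite groth_prob (prob_disjoint_union _ evE uniq).
apply: eq_bigr => T PT; rewrite prob_cylinder; last first.
  rewrite disjoints_subset; apply/subsetP => -[B t]; rewrite !inE /= => /andP[-> tT].
  exact: dis tT.
rewrite !prod_vertices -big_split /=; apply: eq_bigr => B _; congr (_ * _).
by apply: eq_bigr => t _; rewrite coentry_weightE.
Qed.

End RotheTableaux.

(** * The two partitions of the tableau event *)

Section RotheFormulas.
Variables (n : nat) (w : 'S_n).
Local Notation box := ('I_n * 'I_n)%type.
Local Notation entry := 'I_n.+1.
Implicit Types (B C : box) (t m : entry) (f g : {ffun box -> entry}) (S T : filling n).
Implicit Types (Z : {set box * entry}).
Local Notation flag0 := (@flag0 n).

Definition update f B m : {ffun box -> entry} := [ffun C => if C == B then m else f C].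

Definition max_tab f g : {ffun box -> entry} :=
  [ffun B => if (f B <= g B)%N then g B else f B].

Lemma max_tabE f g B : max_tab f g B = maxn (f B) (g B) :> nat.
Proof. by rewrite ffunE; case: leqP; lia. Qed.

Lemma flagged_max f g : flagged_tab w f -> flagged_tab w g -> flagged_tab w (max_tab f g).
Proof.
case=> f1 f2 f3 [g1 g2 g3]; split=> [B DB|B C DB DC e lt|B C DB DC e lt]; rewrite !max_tabE.
- by have := f1 B DB; have := g1 B DB; lia.
- by have := f2 B C DB DC e lt; have := g2 B C DB DC e lt; lia.
by have := f3 B C DB DC e lt; have := g3 B C DB DC e lt; lia.
Qed.

Lemma replace_single f B m : B \in rothe w ->
  replace (single w f) B m = single w (update f B m).
Proof.
move=> DB; apply/ffunP => C; rewrite !ffunE; case: eqP => [->|_]; first by rewrite DB.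
by [].
Qed.

Lemma larger_entriesP f B m : B \in rothe w ->
  reflect ((f B < m)%N /\ flagged_tab w (update f B m))
    (m \in larger_entries w flag0 (single w f) B).
Proof.
move=> DB; rewrite inE replace_single //.
have -> : [forall t in single w f B, (t < m)%N] = (f B < m)%N.
  rewrite ffunE DB; apply/forall_inP/idP => [/(_ _ (set11 _)) //|lt t /set1P-> //].
by apply: (iffP andP) => -[-> /single_SRT].
Qed.

(** The entry to be replaced is a lowest and leftmost one among those where the two
    tableaux differ. *)
Lemma exists_larger_entry f g B : flagged_tab w f -> flagged_tab w g ->
  (forall C, C \in rothe w -> (f C <= g C)%N) -> B \in rothe w -> (f B < g B)%N ->
  exists2 C, C \in rothe w & g C \in larger_entries w flag0 (single w f) C.
Proof.
case=> f1 f2 f3 [g1 g2 g3] le DB ltB.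
pose P C := (C \in rothe w) && (f C < g C)%N.
have PB : P B by rewrite /P DB.
case: (arg_maxnP (fun C : box => C.1 + (n - C.2))%N PB) => C /andP[DC ltC] maxC.
have eqC C' : C' \in rothe w -> (C.1 + (n - C.2) < C'.1 + (n - C'.2))%N -> f C' = g C'.
  move=> DC' lt; apply: val_inj; apply/eqP; rewrite /= eqn_leq le //= leqNgt; apply/negP => lt'.
  by have := maxC C'; rewrite /P DC' lt' => /(_ isT) /=; rewrite leqNgt lt.
exists C => //; apply/larger_entriesP => //; split=> //.
split=> [C' D'|C1 C2 D1 D2 e lt|C1 C2 D1 D2 e lt]; rewrite !ffunE.
- by case: eqP => [->|_]; [exact: g1|exact: f1].
- have ltn2 := ltn_ord C2.2; case: eqP => [e2|_]; case: eqP => [e1|_].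
  + by [].
  + have -> : f C1 = g C1 by apply: eqC => //; rewrite -e2 e ltn_add2l ltn_sub2l // (ltn_trans lt).
    by rewrite -e2; apply: g2.
  + by apply: leq_trans (ltnW ltC); rewrite -e1; apply: f2.
  exact: f2.
case: eqP => [e1|_]; case: eqP => [e2|_].
- by move: lt; rewrite e1 e2 ltnn.
- have -> : f C2 = g C2 by apply: eqC => //; rewrite -e1 e ltn_add2r.
  by rewrite -e1; apply: g3.
- by apply: ltn_trans ltC; rewrite -e2; apply: f3.
exact: f3.
Qed.

Lemma SRT_entriesP f B : flagged_tab w f -> B \in rothe w -> f B \in SRT_entries w flag0 B.
Proof.
move=> vf DB; apply/bigcupP; exists (single w f); first exact/single_SRT.
by rewrite ffunE DB set11.
Qed.

Lemma SRT_entries_bound B t : t \in SRT_entries w flag0 B -> B \in rothe w ->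
  (0 < t <= B.1.+1)%N.
Proof.
case/bigcupP => T ST + DB; rewrite (SRT_single ST) ffunE DB => /set1P->.
by have [-> //] := SRT_flagged ST.
Qed.

Hypothesis hw : avoids1432 w.

(** The summand of [T] is the probability that the selected admissible entries are exactly those of
    [T]. *)
Lemma groth_LSVRT :
  groth w =
    \sum_(T in LSVRT w flag0 | [forall B in rothe w, T B \subset SRT_entries w flag0 B])
      \prod_(B in rothe w)
        ((\prod_(t in T B) entry_weight w B t) *
         (\prod_(t in SRT_entries w flag0 B :\: T B) coentry_weight w B t)).
Proof.
apply: (groth_cylinders hw (F := fun T B => SRT_entries w flag0 B :\: T B)) => [Z|Z T T'|T B t].
- apply/srt_eventP/existsP => [[f vf sub]|[T]].
    pose T : filling n := [ffun B => if B \in rothe w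
      then [set t in SRT_entries w flag0 B | (B, t) \in Z] else set0].
    have TE B t : B \in rothe w -> (t \in T B) = (t \in SRT_entries w flag0 B) && ((B, t) \in Z).
      by move=> DB; rewrite ffunE DB inE.
    exists T; apply/andP; split; last first.
      apply/andP; split.
        by apply/subsetP => -[B t]; rewrite inE /= => /andP[DB]; rewrite TE // => /andP[].
      rewrite disjoints_subset; apply/subsetP => -[B t]; rewrite inE /= => /andP[DB /setDP[tE]].
      by rewrite TE // tE inE.
    have fT B : B \in rothe w -> f B \in T B by move=> DB; rewrite TE // SRT_entriesP // sub.
    apply/andP; split; last first.
      by apply/forall_inP => B DB; apply/subsetP => t; rewrite TE // => /andP[].
    rewrite inE; apply/andP; split; last first.
      apply/forall_inP => B DB; apply/forall_inP => t; rewrite TE // flag0E => /andP[tE _].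
      by have /andP[] := SRT_entries_bound tE DB.
    apply/andP; split.
      apply/forallP => B; case DB: (B \in rothe w); last by rewrite ffunE DB.
      apply/andP; split; first by apply/set0Pn; exists (f B); apply: fT.
      by rewrite TE // negb_and; apply/orP; left; apply/negP => /SRT_entries_bound/(_ DB).
    apply/existsP; exists (single w f); apply/andP; split.
      by have /single_SRT := vf; rewrite inE => /andP[].
    by apply/forall_inP => B DB; rewrite ffunE DB sub1set fT.
  case/andP=> /andP[]; rewrite inE => /andP[/andP[_ /existsP[S /andP[tabS /forall_inP sub]]] flg] _.
  case/andP=> /subsetP TZ _.
  have SS : S \in SRT w flag0.
    rewrite inE tabS; apply/forall_inP => B DB; apply/forall_inP => t tS.
    by have /forall_inP/(_ B DB)/forall_inP := flg; apply; apply: (subsetP (sub B DB)).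
  exists (the_entry S); first exact: SRT_flagged.
  move=> B DB; apply: TZ; rewrite inE /= DB; apply: (subsetP (sub B DB)).
  have -> : S B = [set the_entry S B] by rewrite {1}(SRT_single SS) ffunE DB.
  exact: set11.
- have sub T1 T2 : (T1 \in LSVRT w flag0) &&
      [forall B in rothe w, T1 B \subset SRT_entries w flag0 B] ->
      (vertices w T1 \subset Z) ->
      [disjoint vertices w (fun B => SRT_entries w flag0 B :\: T2 B) & Z] ->
      forall B, B \in rothe w -> T1 B \subset T2 B.
    move=> /andP[_ /forall_inP sE] /subsetP sZ dis B DB; apply/subsetP => t tT.
    have : (B, t) \in Z by apply: sZ; rewrite inE /= DB.
    apply: contraTT => tN; rewrite (disjointFr dis) // inE /= DB inE tN.
    exact: (subsetP (sE B DB)).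
  move=> PT PT' /andP[s1 d1] /andP[s2 d2]; apply/ffunP => B.
  case DB: (B \in rothe w); first by apply/eqP; rewrite eqEsubset !(sub, PT, PT').
  have out T1 : T1 \in LSVRT w flag0 -> T1 B = set0.
    by rewrite inE => /andP[/andP[/forallP/(_ B)]]; rewrite DB => /eqP.
  by case/andP: PT => /out-> _; case/andP: PT' => /out->.
by move=> _ tT; rewrite inE tT.
Qed.

(** The summand of [T] is the probability that [T] is the largest selected tableau: by
    [exists_larger_entry], it suffices that no larger replacement of one entry is selected. *)
Lemma groth_SRT :
  groth w =
    \sum_(T in SRT w flag0)
      \prod_(B in rothe w)
        ((\prod_(t in T B) entry_weight w B t) *
         (\prod_(t in larger_entries w flag0 T B) coentry_weight w B t)).
Proof.
apply: (groth_cylinders hw (F := larger_entries w flag0)) => [Z|Z T T' ST ST'|T B t].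
- apply/idP/existsP => [|[T /and3P[ST sub _]]]; last by apply/exists_inP; exists T.
  case/srt_eventP => f0 vf0 sub0.
  pose P f := (single w f \in SRT w flag0) && [forall B in rothe w, (B, f B) \in Z].
  have P0 : P f0 by apply/andP; split; [exact/single_SRT | exact/forall_inP].
  (* A selected replacement by a larger entry would increase the sum of the entries. *)
  case: (arg_maxnP (fun f => \sum_(B in rothe w) f B)%N P0) => f /andP[Sf sub] maxf.
  exists (single w f); rewrite Sf vertices_single sub /=.
  rewrite disjoints_subset; apply/subsetP => -[B m]; rewrite inE /=.
  case/andP=> DB /(larger_entriesP _ _ DB)[lt vm]; rewrite inE; apply/negP => mZ.
  have Pm : P (update f B m).
    apply/andP; split; first exact/single_SRT.
    apply/forall_inP => C DC; rewrite ffunE; case: eqP => [->//|_].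
    exact: (forall_inP sub).
  have /= := maxf _ Pm; rewrite leqNgt => /negP[].
  rewrite (bigD1 B) //= [X in (_ < X)%N](bigD1 B) //= ffunE eqxx -addSn leq_add //.
  by apply: leq_sum => C /andP[_ /negbTE ne]; rewrite ffunE ne.
- have key f g : flagged_tab w f -> flagged_tab w g ->
      (forall B, B \in rothe w -> (B, g B) \in Z) ->
      [disjoint vertices w (larger_entries w flag0 (single w f)) & Z] ->
      (forall B, B \in rothe w -> (f B <= g B)%N) -> single w f = single w g.
    move=> vf vg gZ dis le; apply/ffunP => B; rewrite !ffunE; case DB: (B \in rothe w) => //.
    congr [set _]; apply: val_inj; apply/eqP; rewrite /= eqn_leq le //= leqNgt.
    apply/negP => lt; have [C DC gC] := exists_larger_entry vf vg le DB lt.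
    by move: (gZ C DC); rewrite (disjointFr dis) // inE /= DC.
  rewrite (SRT_single ST) (SRT_single ST').
  move: (SRT_flagged ST) (SRT_flagged ST'); move: (the_entry T) (the_entry T') => f g vf vg.
  rewrite !vertices_single => /andP[/forall_inP fZ fd] /andP[/forall_inP gZ gd].
  (* Both tableaux equal their pointwise maximum, which is selected too. *)
  have vm := flagged_max vf vg.
  have mZ B : B \in rothe w -> (B, max_tab f g B) \in Z.
    by move=> DB; rewrite ffunE; case: ifP => _; [apply: gZ | apply: fZ].
  rewrite (key f (max_tab f g)) //; last by move=> B _; rewrite max_tabE leq_maxl.
  by rewrite (key g (max_tab f g)) // => B _; rewrite max_tabE leq_maxr.
move=> ST tT; rewrite inE negb_and; apply/orP; left.
by apply/forall_inPn; exists t; rewrite ?ltnn.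
Qed.

End RotheFormulas.

(** The condition [T B \subset SRT_entries w _ B] is not part of the definition of a
    limit tableau.  The first formula fails without it: for the one-line notation [231]
    the second square may carry [{1, 2}], although its only entry in a single-valued
    tableau is 2. *)
Theorem theorem1p4 (n : nat) (w : 'S_n) (hw : avoids1432 w) :
  groth w =
    \sum_(T in LSVRT w (@flag0 n) |
             [forall B in rothe w, T B \subset SRT_entries w (@flag0 n) B])
      \prod_(B in rothe w)
        ((\prod_(t in T B) entry_weight w B t) *
         (\prod_(t in SRT_entries w (@flag0 n) B :\: T B) coentry_weight w B t))
  /\
  groth w =
    \sum_(T in SRT w (@flag0 n))
      \prod_(B in rothe w)
        ((\prod_(t in T B) entry_weight w B t) *
         (\prod_(t in larger_entries w (@flag0 n) T B) coentry_weight w B t)).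
Proof. by split; [exact: groth_LSVRT|exact: groth_SRT]. Qed.
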